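(* Let $A\in\mathcal B_\nu^+$, $0\le t<t^\star(A)$ and $x\in E$. Then, when $n$ goes to infinity, $$Y_n(A,t)^+\sum_{i=0}^{n-1}\lambda(Z_i,t)\mathbf 1_{\{Z_i\in A\}}\mathbf 1_{\{S_{i+1}\ge t\}}\longrightarrow l(A,t)=\frac{\int_A f(z,t)\,\nu(dz)}{\int_A G(z,t)\,\nu(dz)}\qquad\mathbf P_x\text{-a.s.}$$ The function $l(A,\cdot)$ is continuous on $[0,t^\star(A)[$. In particular, $$K_t(A)=\sup_{0\le s\le t}|l(A,s)|<+\infty.$$
   Context: Setting. $(\mathcal E,d)$ is a separable metric space and $E\subset\mathcal E$ is open, with Borel $\sigma$-field $\mathcal B(E)$ and boundary $\partial E$. Let $Q$ be a Markov transition kernel on $(E,\mathcal B(E))$, $\lambda:E\times\mathbf R_+\to\mathbf R_+$ (the jump rate) and $t^\star:E\to\,]0,+\infty]$ (the deterministic censorship). On a probability space $(\Omega,\mathcal A,\mathbf P_{\nu_0})$, $(Z_n)_{n\ge0}$ is a Markov chain with kernel $Q$ and initial distribution $\nu_0$, written $Z_n=\psi(Z_{n-1},\varepsilon_{n-1})$ for $n\ge1$, with $\psi$ measurable and $(\varepsilon_n)_{n\ge0}$ i.i.d. The interarrival times satisfy $S_0=0$ and, for $n\ge1$, $S_n=\varphi(Z_{n-1},\delta_{n-1})$ with $\varphi$ measurable and $(\delta_n)_{n\ge0}$ i.i.d., independent of $(\varepsilon_n)_{n\ge0}$; both sequences are independent of $Z_0$. The law of $S_n$, $n\ge1$, is given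 for $t\ge0$ by $$\mathbf P_{\nu_0}(S_n>t\mid\{Z_i:i\ge0\},S_0,\dots,S_{n-1})=\mathbf P_{\nu_0}(S_n>t\mid Z_{n-1})=\exp\Big(-\int_0^t\lambda(Z_{n-1},s)\,ds\Big)\mathbf 1_{\{0\le t<t^\star(Z_{n-1})\}}.$$ $\mathbf P_x$ denotes $\mathbf P_{\nu_0}$ with $\nu_0=\delta_{\{x\}}$. Put $G(\xi,t)=\exp(-\int_0^t\lambda(\xi,s)\,ds)$ and $f(\xi,t)=\lambda(\xi,t)G(\xi,t)$. Standing assumptions. $Q$ is diffuse (it does not charge singletons). There is a probability measure $\nu$ such that, for any initial distribution $\nu_0=\delta_{\{x\}}$, $x\in E$, the law $\nu_n$ of $Z_n$ satisfies $\lim_{n}\|\nu_n-\nu\|_{TV}=0$. Moreover: (1) there is $[\lambda]_{Lip}>0$ with $|\lambda(\xi,s)-\lambda(\xi',s)|\le[\lambda]_{Lip}\,d(\xi,\xi')$ for all $\xi,\xi'\in E$, $s\ge0$; (2) there is a locally integrable $M:\mathbf R_+\to\mathbf R_+$ with $\lambda(\xi,s)\le M(s)$ for all $\xi\in E$, $s\ge0$; (3) $f$ is continuous in time; (4) $f$ is bounded; (5) $t^\star$ is continuous. Notation. $\mathcal B_\nu^+=\{A\in\mathcal B(E): A\text{ relatively compact},\ \nu(A)>0,\ \overline A\cap\partial E=\emptyset\}$; $t^\star(A)=\inf_{\xi\in A}t^\star(\xi)$. For $0\le t<t^\star(A)$, $Y_n(A,t)=\sum_{i=0}^{n-1}\mathbf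 1_{\{S_{i+1}\ge t\}}\mathbf 1_{\{Z_i\in A\}}$, and $Y_n(A,t)^+=1/Y_n(A,t)$ if $Y_n(A,t)\ne0$, $Y_n(A,t)^+=0$ if $Y_n(A,t)=0$. *)

(* Defs.v *)
From HB Require Import structures.
From mathcomp Require Import all_boot all_order all_algebra finmap.
From mathcomp Require Import all_classical all_reals all_analysis.
From mathcomp Require Import measurable_realfun.

Set Implicit Arguments.
Unset Strict Implicit.
Unset Printing Implicit Defensive.

Import Order.TTheory GRing.Theory Num.Theory.
Import numFieldNormedType.Exports.

Local Open Scope classical_set_scope.
Local Open Scope ring_scope.

(* The subset E of a metric space as a topological and measurable space in its
   own right: subspace topology, and the Borel sigma-algebra of that topology.
   The witness e0 only serves to make the type pointed, which the library
   requires of every measurable type; nothing else depends on it. *)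
Definition state (R : realType) (X : metricType R) (E : set X) (e0 : E) : Type :=
  set_type E.

Section state_instances.
Context (R : realType) (X : metricType R) (E : set X) (e0 : E).

HB.instance Definition _ := PseudoMetric.copy (state e0) (set_type E).
HB.instance Definition _ := isPointed.Build (state e0) e0.

Let borel : set (set (state e0)) := <<s @open (state e0) >>.

Let borel0 : borel set0. Proof. exact: sigma_algebra0. Qed.

Let borelC B : borel B -> borel (~` B).
Proof. by move=> mB; rewrite -setTD; exact: sigma_algebraCD. Qed.

Let borelU (F : (set (state e0))^nat) :
  (forall i, borel (F i)) -> borel (\bigcup_i F i).
Proof. exact: sigma_algebra_bigcup. Qed.

HB.instance Definition _ :=
  @isMeasurable.Build (sigma_display (@open (state e0))) (state e0)
    borel borel0 borelC borelU.

End state_instances.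

Definition separable_space (X : topologicalType) : Prop :=
  exists D : set X, countable D /\ dense D.

Definition boundary (X : topologicalType) (E : set X) : set X :=
  closure E `\` interior E.

Section probability_notions.
Local Open Scope ereal_scope.
Context (R : realType) (d : measure_display) (T : measurableType d).

(* Some authors use twice this quantity; convergence to 0 is unaffected. *)
Definition tv_dist (mu nu : set T -> \bar R) : \bar R :=
  ereal_sup [set `|mu B - nu B| | B in measurable].

Variable P : probability T R.

Definition sigma_rv (d' : measure_display) (T' : measurableType d')
    (Y : T -> T') : set (set T) :=
  preimage_set_system setT Y measurable.

Definition sigma_rvs (d' : measure_display) (T' : measurableType d')
    (J : set nat) (Y : nat -> T -> T') : set (set T) :=
  <<s \bigcup_(i in J) sigma_rv (Y i) >>.

(* h is a version of the conditional probability P(B | F). *)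
Definition is_cond_prob (F : set (set T)) (B : set T) (h : T -> \bar R) : Prop :=
  (forall C : set (\bar R), measurable C -> F (h @^-1` C)) /\
  (forall H : set T, F H -> P (B `&` H) = \int[P]_(w in H) h w).

Definition independent (F H : set (set T)) : Prop :=
  forall A B : set T, F A -> H B -> P (A `&` B) = P A * P B.

Definition mutually_independent (F : nat -> set (set T)) : Prop :=
  forall (J : {fset nat}) (A : nat -> set T),
    (forall i, i \in J -> F i (A i)) ->
    P (\bigcap_(i in [set` J]) A i) = (\prod_(i <- J) fine (P (A i)))%R%:E.

Definition iid (d' : measure_display) (T' : measurableType d')
    (Y : nat -> T -> T') : Prop :=
  mutually_independent (fun n => sigma_rv (Y n)) /\
  (forall (n : nat) (B : set T'), measurable B ->
     P (Y n @^-1` B) = P (Y 0%N @^-1` B)).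

End probability_notions.

Section model.
Context (R : realType) (X : metricType R) (E : set X) (e0 : E).
Local Notation EE := (state e0).

Section rate.
Variable lam : EE -> R -> R.

Definition Glam (xi : EE) (t : R) : R :=
  expR (- (\int[lebesgue_measure]_(s in `[0, t]) lam xi s)).

Definition flam (xi : EE) (t : R) : R := lam xi t * Glam xi t.

Definition llam (nu : probability EE R) (A : set EE) (t : R) : R :=
  (\int[nu]_(z in A) flam z t) / (\int[nu]_(z in A) Glam z t).

Definition Klam (nu : probability EE R) (t : R) (A : set EE) : \bar R :=
  ereal_sup [set `|llam nu A s|%:E | s in `[0, t]].

Definition survival (tstar : EE -> \bar R) (xi : EE) (t : R) : R :=
  Glam xi t * ((t%:E < tstar xi)%E)%:R.

End rate.

(* Closure, compactness and boundary are taken in the ambient space X. *)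
Definition Bplus (nu : probability EE R) (A : set EE) : Prop :=
  let A' : set X := [set val z | z in A] in
  [/\ measurable A, precompact A', (0 < nu A)%E &
      closure A' `&` boundary E = set0].

Definition tstar_inf (tstar : EE -> \bar R) (A : set EE) : \bar R :=
  ereal_inf [set tstar xi | xi in A].

Section process.
Context (dO dU dV : measure_display) (Omega : measurableType dO)
  (U : measurableType dU) (V : measurableType dV).
Variables (Q : R.-pker EE ~> EE) (lam : EE -> R -> R) (tstar : EE -> \bar R).
Variables (psi : EE * U -> EE) (phi : EE * V -> \bar R).
Variables (Z : nat -> {mfun Omega >-> EE}) (S : nat -> {mfun Omega >-> \bar R}).
Variables (eps : nat -> {mfun Omega >-> U}) (delta : nat -> {mfun Omega >-> V}).

(* The interarrival times take extended values: when tstar = +oo nothing forces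
   lam to have infinite integral, so S = +oo may have positive probability.
   Nonnegativity is not assumed separately; the law at t = 0 gives S > 0 almost
   surely. *)
Record marked_renewal_process (nu0 : probability EE R) (P : probability Omega R)
    : Prop := {
  mrp_init : forall B : set EE, measurable B ->
    distribution P (Z 0%N) B = nu0 B ;
  mrp_markov : forall (n : nat) (B : set EE), measurable B ->
    is_cond_prob P (sigma_rvs `I_n.+1 Z) (Z n.+1 @^-1` B)
      (fun w => Q (Z n w) B) ;
  mrp_Z : forall (n : nat) (w : Omega), Z n.+1 w = psi (Z n w, eps n w) ;
  mrp_S0 : forall w : Omega, S 0%N w = 0%E ;
  mrp_S : forall (n : nat) (w : Omega), S n.+1 w = phi (Z n w, delta n w) ;
  mrp_eps : iid P eps ;
  mrp_delta : iid P delta ;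
  mrp_eps_delta : independent P (sigma_rvs setT eps) (sigma_rvs setT delta) ;
  mrp_Z0 : independent P (sigma_rv (Z 0%N))
    <<s sigma_rvs setT eps `|` sigma_rvs setT delta >> ;
  mrp_law : forall (n : nat) (t : R), 0 <= t ->
    is_cond_prob P <<s sigma_rvs setT Z `|` sigma_rvs `I_n.+1 S >>
      [set w | (t%:E < S n.+1 w)%E]
      (fun w => (survival lam tstar (Z n w) t)%:E) ;
  mrp_law_Z : forall (n : nat) (t : R), 0 <= t ->
    is_cond_prob P (sigma_rv (Z n))
      [set w | (t%:E < S n.+1 w)%E]
      (fun w => (survival lam tstar (Z n w) t)%:E)
}.

Record standing_assumptions (Pr : probability EE R -> probability Omega R)
    (nu : probability EE R) : Prop := {
  sa_diffuse : forall x y : EE, Q x [set y] = 0%E ;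
  sa_ergodic : forall x : EE,
    tv_dist (distribution (Pr (dirac x)) (Z n)) nu @[n --> \oo] --> 0%E ;
  sa_lipschitz : exists2 L : R, 0 < L &
    forall (xi xi' : EE) (s : R), 0 <= s ->
      `|lam xi s - lam xi' s| <= L * mdist (val xi) (val xi') ;
  (* Local integrability on [0, +oo[; the library's locally_integrable
     presupposes an open domain. *)
  sa_dominated : exists M : R -> R,
    [/\ forall s, 0 <= s -> 0 <= M s,
        forall T, 0 <= T ->
          lebesgue_measure.-integrable `[0, T] (EFin \o M) &
        forall (xi : EE) (s : R), 0 <= s -> lam xi s <= M s] ;
  sa_f_continuous : forall xi : EE, {within (`[0, +oo[ : set R), continuous (flam lam xi)} ;
  sa_f_bounded : exists C : R,
    forall (xi : EE) (t : R), 0 <= t -> `|flam lam xi t| <= C ;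
  sa_tstar_continuous : continuous tstar
}.

Definition Yrisk (A : set EE) (t : R) (n : nat) (w : Omega) : R :=
  \sum_(i < n) ((t%:E <= S i.+1 w)%E)%:R * \1_A (Z i w).

Definition Yplus (A : set EE) (t : R) (n : nat) (w : Omega) : R :=
  if Yrisk A t n w == 0 then 0 else 1 / Yrisk A t n w.

End process.
End model.

(* Main.v *)
Require Import Defs.
From HB Require Import structures.
From mathcomp Require Import all_boot all_order all_algebra finmap.
From mathcomp Require Import all_classical all_reals all_analysis.
From mathcomp Require Import measurable_realfun.
From mathcomp Require Import ring lra.

Set Implicit Arguments.
Unset Strict Implicit.
Unset Printing Implicit Defensive.

Import Order.TTheory GRing.Theory Num.Theory.
Import numFieldNormedType.Exports.

Local Open Scope classical_set_scope.
Local Open Scope ring_scope.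

(** Let J_i be the event t < S_{i+1}. Almost surely it coincides with
    t <= S_{i+1} whenever Z_i lies in A, because the survival function of S_{i+1}
    given Z_i = z is G(z, .) near t for z in A, and is continuous there
    (ae_late). Both sums of the statement are therefore sums of a(Z_i) 1_{J_i}
    for some bounded a.

    The marked chain (Z_i, J_i) is a hidden Markov process: given its past, the
    law of its future depends on the current state alone (path_markov). So an
    event of the path space is described by the function sending y to its
    probability kappa(y) under P_y. For a shift-invariant event, kappa(y) is the
    mean of kappa under the law of Z_n, for every n; as this law converges to nu,
    kappa is constant (path_kernel_invariant), and the event is independent of
    (Z_0, J_0) under P_nu (independent_head).

    Let f be a bounded function of (Z_0, J_0) with negative mean under P_nu, and U
    the event that the partial sums of f along the path are unbounded above. U is
    shift-invariant, and the maximal ergodic theorem under P_nu gives that f has a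
    nonnegative integral on U (integral_unbounded_sums). By independence this
    integral is P_nu(U) times the mean of f, so P_nu(U) = 0, whence P_x(U) = 0 for
    every x (ae_bounded_sums).

    Three families of functions f then give the limit of the ratio X_n / Y_n of
    the two sums (ratio_cvg). With f = eta - 1_A 1_J, Y_n grows at least linearly;
    with f = (lambda - l - eps) 1_A 1_J and f = (l - eps - lambda) 1_A 1_J, the
    difference between X_n and l Y_n is at most eps Y_n up to a bounded error.

    The continuity of l follows from dominated convergence in its numerator and
    denominator, the latter being bounded below by nu(A) times
    exp(- int_0^t M). *)

(** * Positive functionals and the monotone class argument *)

Section monotone_functionals.
Local Open Scope ereal_scope.
Context (R : realType) (d : measure_display) (T : measurableType d).

Definition ge0_mfun (f : T -> \bar R) : Prop :=
  (forall x, 0 <= f x) /\ measurable_fun setT f.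

(** The properties that the maps f |-> E[a f(Y)], f |-> E[a Qf(Y)] and f |-> f(y)
    share, and that make a functional determined by its values on indicators.
    Working with them avoids building a measure for each such map. *)
Record pos_functional (L : (T -> \bar R) -> \bar R) : Prop := {
  pos_functionalD : forall f g, ge0_mfun f -> ge0_mfun g ->
    L (f \+ g) = L f + L g ;
  pos_functionalZ : forall (r : R) f, (0 <= r)%R -> ge0_mfun f ->
    L (fun x => r%:E * f x) = r%:E * L f ;
  pos_functional_le : forall f g, ge0_mfun f -> ge0_mfun g ->
    (forall x, f x <= g x) -> L f <= L g ;
  pos_functional_lim : forall (f_ : (T -> \bar R)^nat) f,
    (forall n, ge0_mfun (f_ n)) ->
    (forall x, nondecreasing_seq (f_ ^~ x)) ->
    (forall x, f_ n x @[n --> \oo] --> f x) ->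
    L (f_ n) @[n --> \oo] --> L f }.

Lemma ge0_mfun_indic (B : set T) : measurable B ->
  ge0_mfun (EFin \o \1_B : T -> \bar R).
Proof. by move=> mB; split => [x|]; [rewrite lee_fin|exact/measurable_EFinP]. Qed.

Import HBNNSimple.

(** Every nonnegative measurable function is an increasing limit of nonnegative
    combinations of indicators. *)
Lemma eq_pos_functional (L1 L2 : (T -> \bar R) -> \bar R) :
  pos_functional L1 -> pos_functional L2 ->
  (forall B, measurable B ->
    L1 (EFin \o \1_B) = L2 (EFin \o \1_B)) ->
  forall f, ge0_mfun f -> L1 f = L2 f.
Proof.
move=> L1P L2P L12 f [f0 mf].
have gesum (g : {nnsfun T >-> R}) r : (0 <= r)%R ->
    ge0_mfun (fun x => r%:E * (\1_(g @^-1` [set r]) x)%:E).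
  move=> r0; split => [x|]; first by rewrite mule_ge0// lee_fin.
  by apply: measurable_funeM; apply/measurable_EFinP.
have Lg (g : {nnsfun T >-> R}) : L1 (EFin \o g) = L2 (EFin \o g).
  pose s : seq R := finmap.enum_fset (fset_set (range g)).
  have s0 r : r \in s -> (0 <= r)%R.
    by rewrite in_fset_set// inE => -[x _ <-].
  have -> : EFin \o g =
      (fun x => \sum_(r <- s) (r%:E * (\1_(g @^-1` [set r]) x)%:E)).
    apply/funext => x /=; rewrite {1}fimfunE fsbig_finite//= -sumEFin.
    by apply: eq_bigr => r _; rewrite EFinM.
  elim: s s0 => [_|r s ih s0].
    have -> : (fun x : T => \sum_(r <- [::]) (r%:E * (\1_(g @^-1` [set r]) x)%:E)) =
        (fun x : T => 0%:E * (EFin \o \1_set0) x).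
      by apply/funext => x; rewrite big_nil mul0e.
    have i0 : ge0_mfun (EFin \o \1_set0 : T -> \bar R) by exact: ge0_mfun_indic.
    by rewrite (pos_functionalZ L1P (lexx _) i0) (pos_functionalZ L2P (lexx _) i0) L12.
  have s0' x : x \in s -> (0 <= x)%R by move=> xs; apply: s0; rewrite inE xs orbT.
  have r0 : (0 <= r)%R by apply: s0; rewrite inE eqxx.
  have -> : (fun x : T => \sum_(j <- r :: s) (j%:E * (\1_(g @^-1` [set j]) x)%:E)) =
     (fun x => r%:E * (\1_(g @^-1` [set r]) x)%:E) \+
     (fun x => \sum_(j <- s) (j%:E * (\1_(g @^-1` [set j]) x)%:E)).
    by apply/funext => x; rewrite big_cons.
  have h1 := gesum g _ r0.
  have h2 : ge0_mfun (fun x => \sum_(j <- s) (j%:E * (\1_(g @^-1` [set j]) x)%:E)).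
    split => [x|].
      rewrite big_seq; apply: sume_ge0 => j /s0' j0.
      by rewrite mule_ge0// lee_fin.
    apply: emeasurable_sum => j; apply: measurable_funeM.
    exact/measurable_EFinP.
  have h3 : ge0_mfun (EFin \o \1_(g @^-1` [set r])).
    by split => [x|]; [rewrite /= lee_fin|exact/measurable_EFinP].
  rewrite (pos_functionalD L1P)// (pos_functionalD L2P)// ih//.
  congr (_ + _).
  rewrite [LHS](pos_functionalZ L1P r0 h3) [RHS](pos_functionalZ L2P r0 h3).
  by rewrite L12.
pose f_ := nnsfun_approx measurableT mf.
have ge n : ge0_mfun (EFin \o f_ n).
  by split => [x|]; [rewrite /= lee_fin|exact/measurable_EFinP].
have nd x : nondecreasing_seq (fun n => (f_ n x)%:E).
  by move=> m n mn; rewrite lee_fin; exact/lefP/nd_nnsfun_approx.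
have cv x : (f_ n x)%:E @[n --> \oo] --> f x by exact: cvg_nnsfun_approx.
have c1 := pos_functional_lim L1P ge nd cv.
have c2 := pos_functional_lim L2P ge nd cv.
apply: (cvg_unique _ c1) => //.
rewrite (_ : (fun n => _) = (fun n => L2 (EFin \o f_ n)))//.
by apply/funext => n; exact: Lg.
Qed.

End monotone_functionals.

Section functional_instances.
Local Open Scope ereal_scope.
Context (R : realType) (dO d : measure_display).
Context (Omega : measurableType dO) (T : measurableType d).
Variable P : {measure set Omega -> \bar R}.

Lemma ge0_mfun_comp (Y : Omega -> T) (f : T -> \bar R) :
  measurable_fun setT Y -> ge0_mfun f -> ge0_mfun (f \o Y).
Proof. by move=> mY [f0 mf]; split => [x|] /=; [|exact: measurableT_comp]. Qed.

Lemma ge0_mfunM (f g : T -> \bar R) :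
  ge0_mfun f -> ge0_mfun g -> ge0_mfun (fun x => f x * g x).
Proof.
move=> [f0 mf] [g0 mg]; split => [x|]; first exact: mule_ge0.
exact: emeasurable_funM.
Qed.

(** K stands for a composition with a random variable or for integration
    against a kernel. *)
Lemma pos_functional_integral (a : Omega -> R)
    (K : (T -> \bar R) -> Omega -> \bar R) :
  (forall w, (0 <= a w)%R) -> measurable_fun setT a ->
  (forall f, ge0_mfun f -> ge0_mfun (K f)) ->
  (forall w, pos_functional (K ^~ w)) ->
  pos_functional (fun f => \int[P]_w ((a w)%:E * K f w)).
Proof.
move=> a0 ma mK posK.
have aK f : ge0_mfun f ->
    (forall w, 0 <= (a w)%:E * K f w) /\
    measurable_fun setT (fun w => (a w)%:E * K f w).
  move=> /mK[Kf0 mKf]; split; first by move=> w; rewrite mule_ge0// lee_fin.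
  by apply: emeasurable_funM => //; exact/measurable_EFinP.
split => [f g fP gP|r f r0 fP|f g fP gP fg|f_ f f_P ndf cvf].
- have [Kf0 mKf] := aK _ fP; have [Kg0 mKg] := aK _ gP.
  rewrite -ge0_integralD//=.
  apply: eq_integral => w _; rewrite (pos_functionalD (posK w))// ge0_muleDr//.
  + by have [] := mK _ fP.
  + by have [] := mK _ gP.
- have [Kf0 mKf] := aK _ fP.
  rewrite -ge0_integralZl//=.
  by apply: eq_integral => w _; rewrite (pos_functionalZ (posK w))// muleCA.
- have [Kf0 mKf] := aK _ fP; have [Kg0 mKg] := aK _ gP.
  apply: ge0_le_integral => //= w _.
  by rewrite lee_wpmul2l ?lee_fin//; exact: (pos_functional_le (posK w)).
- have -> : \int[P]_w ((a w)%:E * K f w) =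
      \int[P]_w limn (fun n => (a w)%:E * K (f_ n) w).
    apply: eq_integral => w _; apply/esym/cvg_lim => //.
    by apply: cvgeZl => //; exact: (pos_functional_lim (posK w)).
  apply: cvg_monotone_convergence => //.
  + by move=> n; have [] := aK _ (f_P n).
  + by move=> n w _; have [] := aK _ (f_P n).
  + move=> w _ m n mn; rewrite lee_wpmul2l ?lee_fin//.
    by apply: (pos_functional_le (posK w)) => // x; exact: ndf.
Qed.

Lemma pos_functional_eval (y : T) : pos_functional (fun f : T -> \bar R => f y).
Proof. by split => //. Qed.

Lemma pos_functional_measure (mu : {measure set T -> \bar R}) :
  pos_functional (fun f : T -> \bar R => \int[mu]_y f y).
Proof.
split => [f g [f0 mf] [g0 mg]|r f r0 [f0 mf]|f g [f0 mf] [g0 mg] fg|f_ f f_P ndf cvf].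
- by rewrite -ge0_integralD.
- by rewrite -ge0_integralZl.
- exact: ge0_le_integral.
- have -> : \int[mu]_y f y = \int[mu]_y limn (f_ ^~ y).
    by apply: eq_integral => y _; apply/esym/cvg_lim.
  apply: cvg_monotone_convergence => //.
  + by move=> n; have [] := f_P n.
  + by move=> n w _; have [] := f_P n.
Qed.

End functional_instances.

(** * Conditional expectations of functions *)

Lemma integral_mul_indic (R : realType) d (T : measurableType d)
    (mu : {measure set T -> \bar R}) (H : set T) (f : T -> \bar R) :
  (\int[mu]_w (f w * (\1_H w)%:E) = \int[mu]_(w in H) f w)%E.
Proof.
rewrite [RHS]integral_mkcond; apply: eq_integral => w _.
by rewrite patchE indicE; case: ifPn => wC; rewrite /= ?mule1 ?mule0.
Qed.

Lemma prob_kernel_le1 (R : realType) d (T : measurableType d)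
    (Q : R.-pker T ~> T) (y : T) (B : set T) :
  measurable B -> (Q y B <= 1)%E.
Proof.
move=> mB; rewrite (le_trans (le_measure _ _ _ (@subsetT _ B))) ?inE//.
exact: sprob_kernel_le1.
Qed.

Section conditioning.
Local Open Scope ereal_scope.
Context (R : realType) (dO : measure_display) (Omega : measurableType dO).
Context (P : probability Omega R) (G : set (set Omega)).
Hypothesis Gm : <<s G >> `<=` measurable.

Local Notation OG := (g_sigma_algebraType G).

Lemma measurable_coarse d (T : measurableType d) (f : OG -> T) :
  measurable_fun setT f -> measurable_fun setT (f : Omega -> T).
Proof. by move=> mf _ B mB; apply: Gm; have := mf measurableT B mB. Qed.

(** From h = P(B | <<s G >>) tested on events to the same identity tested on
    functions: g is measurable for the coarse sigma-algebra, so both sides are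
    positive functionals of g on the coarse measurable space. *)
Lemma cond_prob_integral (B : set Omega) (h : Omega -> R) :
  measurable B -> (forall w, (0 <= h w)%R) -> measurable_fun setT h ->
  (forall H, <<s G >> H -> P (B `&` H) = \int[P]_(w in H) (h w)%:E) ->
  forall g : Omega -> \bar R, ge0_mfun (g : OG -> \bar R) ->
  \int[P]_w ((\1_B w)%:E * g w) = \int[P]_w ((h w)%:E * g w).
Proof.
move=> mB h0 mh BH g gP.
have K0 (f : OG -> \bar R) : ge0_mfun f -> ge0_mfun (f : Omega -> \bar R).
  by move=> [f0 mf]; split => //; exact: measurable_coarse.
apply: (@eq_pos_functional R _ OG (fun f => \int[P]_w ((\1_B w)%:E * f w))
  (fun f => \int[P]_w ((h w)%:E * f w))) => // [||C mC].
- apply: (@pos_functional_integral R dO _ Omega OG P (\1_B) (fun f => f)) => //.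
- apply: (@pos_functional_integral R dO _ Omega OG P h (fun f => f)) => //.
- have mC' : measurable (C : set Omega) by exact: Gm.
  rewrite [RHS]integral_mul_indic -BH//.
  rewrite -[X in _ = P X]setIT -[RHS]integral_indic//; last exact: measurableI.
  by apply: eq_integral => w _; rewrite /= -EFinM indicI.
Qed.

(** E[a f(Y')] = E[a Qf(Y)] when Q(Y, .) is the conditional law of Y' given a
    sigma-algebra for which a is measurable. *)
Lemma cond_kernel_integral d (T : measurableType d) (Q : R.-pker T ~> T)
    (Y Y' : Omega -> T) :
  measurable_fun setT Y -> measurable_fun setT Y' ->
  (forall B, measurable B -> forall H, <<s G >> H ->
    P (Y' @^-1` B `&` H) = \int[P]_(w in H) Q (Y w) B) ->
  forall (a : Omega -> R) (f : T -> \bar R),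
    (forall w, (0 <= a w)%R) -> measurable_fun setT (a : OG -> R) ->
    ge0_mfun f ->
    \int[P]_w ((a w)%:E * f (Y' w)) =
    \int[P]_w ((a w)%:E * \int[Q (Y w)]_z f z).
Proof.
move=> mY mY' QB a f a0 ma fP.
have ma' : measurable_fun setT (a : Omega -> R) by exact: measurable_coarse ma.
apply: (@eq_pos_functional R _ T (fun f => \int[P]_w ((a w)%:E * f (Y' w)))
  (fun f => \int[P]_w ((a w)%:E * \int[Q (Y w)]_z f z))) => // [||B mB].
- apply: (@pos_functional_integral R dO _ Omega T P a (fun f => f \o Y')) => //.
  + by move=> h hP; exact: ge0_mfun_comp.
  + by move=> w; exact: pos_functional_eval.
- apply: (@pos_functional_integral R dO _ Omega T P a
    (fun f w => \int[Q (Y w)]_z f z)) => //.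
  + move=> h [h0 mh]; split; first by move=> w; exact: integral_ge0.
    apply: measurable_fun_integral_kernel => // U mU.
    exact: (measurableT_comp (measurable_kernel Q U mU)).
  + by move=> w; exact: pos_functional_measure.
- have Qfin w : (fine (Q (Y w) B))%:E = Q (Y w) B.
    rewrite fineK// ge0_fin_numE//.
    exact: le_lt_trans (prob_kernel_le1 Q (Y w) mB) (ltry _).
  transitivity (\int[P]_w ((\1_(Y' @^-1` B) w)%:E * (EFin \o a) w)).
    by apply: eq_integral => w _; rewrite muleC /= indicE.
  rewrite (@cond_prob_integral _ (fun w => fine (Q (Y w) B)))//.
  + apply: eq_integral => w _; rewrite Qfin muleC integral_indic// setIT//.
  + by rewrite -[X in measurable X]setTI; exact: mY'.
  + apply: measurableT_comp => //.
    exact: (measurableT_comp (measurable_kernel Q B mB)).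
  + by move=> H GH; rewrite QB//; apply: eq_integral => w _; rewrite Qfin.
  + by split => [w|]; [rewrite lee_fin|exact/measurable_EFinP].
Qed.

End conditioning.

(** * The maximal ergodic theorem *)

Lemma measurable_set_lt (R : realType) d (X : measurableType d) (f g : X -> R) :
  measurable_fun setT f -> measurable_fun setT g ->
  measurable [set p | f p < g p].
Proof.
move=> mf mg; rewrite -[X in measurable X]setTI.
exact: (measurable_fun_ltr mf mg measurableT (Y := [set true])).
Qed.

Lemma probability_bounded_integrable (R : realType) d (X : measurableType d)
    (P : probability X R) (g : X -> R) (K : R) : measurable_fun setT g ->
  (forall p, `|g p| <= K) -> P.-integrable setT (EFin \o g).
Proof.
move=> mg gK; apply: measurable_bounded_integrable => //.
  exact: fin_num_fun_lty.
exists K; split; first exact: num_real.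
by move=> x Kx p _ /=; exact: le_trans (gK p) (ltW Kx).
Qed.

Section maximal_ergodic.
Context (R : realType) d (X : measurableType d) (P : probability X R).
Context (theta : X -> X) (f : X -> R) (C : R).
Hypothesis mtheta : measurable_fun setT theta.
Hypothesis theta_pres : forall A, measurable A -> P (theta @^-1` A) = P A.
Hypothesis mf : measurable_fun setT f.
Hypothesis fC : forall p, `|f p| <= C.

(** The maximum of 0 and of the first n partial sums of f along the orbit of p;
    this recursive form is the one on which the proof of the maximal ergodic
    theorem rests. *)
Fixpoint running_max (n : nat) (p : X) : R :=
  if n is n.+1 then Num.max 0 (f p + running_max n (theta p)) else 0.

Let M := running_max.

Let M_ge0 n p : 0 <= M n p.
Proof. by case: n => // n; rewrite /= le_max lexx. Qed.

Let C0 : 0 <= C. Proof. exact: le_trans (normr_ge0 _) (fC point). Qed.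

Let M_le n p : M n p <= n%:R * C.
Proof.
elim: n p => [|n ih] p; first by rewrite mul0r.
rewrite /= ge_max mulr_ge0//= -natr1 mulrDl mul1r addrC lerD//.
exact: le_trans (ler_norm _) (fC p).
Qed.

Let mM n : measurable_fun setT (M n).
Proof.
elim: n => [|n ih]; first exact: measurable_cst.
apply: measurable_maxr; first exact: measurable_cst.
by apply: measurable_funD => //; exact: (measurableT_comp ih).
Qed.

Let M_nd n p : M n p <= M n.+1 p.
Proof.
elim: n p => [|n ih] p; first by rewrite /= le_max lexx.
by rewrite [M _ _]/= [leRHS]/= le_max2// lerD2l.
Qed.

Let sum_le_M n p : \sum_(i < n) f (iter i theta p) <= M n p.
Proof.
elim: n p => [|n ih] p; first by rewrite big_ord0.
rewrite big_ord_recl /= le_max; apply/orP; right; rewrite lerD2l.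
rewrite (eq_bigr (fun i : 'I_n => f (iter i theta (theta p)))); first exact: ih.
by move=> i _; rewrite -iterSr.
Qed.

Let M_cocycle n p : M n.+1 p - M n.+1 (theta p) <= f p * (0 < M n.+1 p)%R%:R.
Proof.
have [Mp|Mp] := ltP 0 (M n.+1 p); last first.
  by rewrite mulr0 subr_le0 (le_trans Mp).
rewrite mulr1 lerBlDr.
have -> : M n.+1 p = f p + M n (theta p).
  have : 0 < f p + M n (theta p) by move: Mp; rewrite [M _ _]/= lt_max ltxx.
  by move=> /ltW h; rewrite [LHS]/= max_r.
by apply: lerD => //; exact: M_nd.
Qed.

(** Garsia's argument: where M_(n+1) > 0 it equals f + M_n o theta, which is at most
    f + M_(n+1) o theta, so that f 1_{M_(n+1) > 0} dominates
    M_(n+1) - M_(n+1) o theta, a function with integral 0. *)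
Lemma maximal_ergodic :
  (forall p, f p != 0 -> exists n, 0 < \sum_(i < n) f (iter i theta p)) ->
  (0 <= \int[P]_p (f p)%:E)%E.
Proof.
move=> fpos.
pose g n p := f p * (0 < M n.+1 p)%R%:R.
have mg n : measurable_fun setT (g n).
  apply: measurable_funM => //.
  rewrite (_ : (fun _ => _) = \1_[set p | 0 < M n.+1 p]).
    apply: measurable_indic; exact: measurable_set_lt.
  by apply/funext => p; rewrite indicE mem_setE.
have gC n p : `|g n p| <= C.
  by rewrite /g; case: (0 < _)%R; rewrite ?mulr1 ?mulr0 ?normr0.
have g0 n : (0 <= \int[P]_p (g n p)%:E)%E.
  have iM : P.-integrable setT (EFin \o M n.+1).
    apply: (@probability_bounded_integrable _ _ _ P _ (n.+1%:R * C)) => // p.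
    by rewrite ger0_norm.
  have iMt : P.-integrable setT (EFin \o (M n.+1 \o theta)).
    apply: (@probability_bounded_integrable _ _ _ P _ (n.+1%:R * C)) => [|p].
      exact: measurableT_comp.
    by have := M_ge0 n.+1 (theta p); move/ger0_norm => /= ->; exact: (M_le n.+1).
  (* the integral vanishes because theta preserves P *)
  have : (\int[P]_p ((EFin \o M n.+1) p - (EFin \o (M n.+1 \o theta)) p) = 0)%E.
    rewrite integralB//.
    rewrite [X in (_ - X)%E](_ : _ = \int[P]_p (M n.+1 p)%:E)%E ?subee//.
      exact: integrable_fin_num.
    rewrite -[LHS]/(\int[P]_p ((EFin \o M n.+1) \o theta) p)%E.
    rewrite -[in LHS](preimage_setT theta) -integral_pushforward//=.
    - apply: eq_measure_integral => A mA _; exact: theta_pres.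
    - by apply/measurable_EFinP; exact: (mM n.+1).
  move=> <-; apply: le_integral => //.
  - exact: integrableB.
  - exact: (@probability_bounded_integrable _ _ _ P _ C).
  - by move=> p _; rewrite /= lee_fin M_cocycle.
have cvg_int : (\int[P]_p (g n p)%:E @[n --> \oo] --> \int[P]_p (f p)%:E)%E.
  apply: (@dominated_cvg _ _ _ P setT measurableT (fun n p => (g n p)%:E) _ (cst C%:E)) => //.
  - by move=> n; exact/measurable_EFinP.
  - move=> p _; apply: cvg_near_cst.
    have [fp|/fpos[N SN]] := eqVneq (f p) 0.
      by near=> n; rewrite /g fp mul0r.
    near=> n; rewrite /g (lt_le_trans SN) ?mulr1//.
    rewrite (le_trans (sum_le_M _ _))//.
    have : (N <= n.+1)%N by rewrite leqW//; near: n; exact: nbhs_infty_ge.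
    by apply: (nondecreasing_seqP (M ^~ p)).1 => k; exact: M_nd.
  - exact: finite_measure_integrable_cst.
  - by move=> n p _; rewrite /= lee_fin.
rewrite -(cvg_lim _ cvg_int)//; apply: lime_ge.
  by apply/cvg_ex; eexists; exact: cvg_int.
exact: nearW.
Unshelve. all: by end_near.
Qed.

End maximal_ergodic.

Section unbounded_sums.
Context (R : realType) d (X : measurableType d).
Context (theta : X -> X) (f : X -> R) (C : R).
Hypothesis mtheta : measurable_fun setT theta.
Hypothesis mf : measurable_fun setT f.
Hypothesis fC : forall p, `|f p| <= C.

(** Unlike the event that the averages of f exceed a level infinitely often,
    this one is exactly invariant under theta. *)
Definition unbounded_sums : set X :=
  [set p | forall K : nat, exists n, K%:R < \sum_(i < n) f (iter i theta p)].

Lemma measurable_orbit_sum n :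
  measurable_fun setT (fun p => \sum_(i < n) f (iter i theta p)).
Proof.
have mi k : measurable_fun setT (fun p => iter k theta p).
  elim: k => [|k ih]; first exact: measurable_id.
  exact: (measurableT_comp mtheta ih).
by apply: measurable_sum => i; exact: (measurableT_comp mf (mi i)).
Qed.

Lemma measurable_unbounded_sums : measurable unbounded_sums.
Proof.
rewrite (_ : unbounded_sums = \bigcap_(K in setT) \bigcup_n
    [set p | (fun=> K%:R : R) p < \sum_(i < n) f (iter i theta p)]).
  apply: bigcap_measurableType => K _; apply: bigcup_measurable => n _.
  by apply: measurable_set_lt => //; exact: measurable_orbit_sum.
apply/seteqP; split => [p pS K _|p pS K].
  by have [n Kn] := pS K; exists n.
by have [n _ Kn] := pS K Logic.I; exists n.
Qed.

(** The partial sums from p and from theta p differ by f p, which is bounded. *)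
Lemma unbounded_sums_invariant p : unbounded_sums (theta p) <-> unbounded_sums p.
Proof.
have sumS n q : \sum_(i < n.+1) f (iter i theta q) =
    f q + \sum_(i < n) f (iter i theta (theta q)).
  by rewrite big_ord_recl; congr (_ + _); apply: eq_bigr => i _; rewrite -iterSr.
have C0 : 0 <= C by exact: le_trans (normr_ge0 _) (fC p).
have Cb := ltW (archi_boundP C0).
have := fC p; rewrite ler_norml => /andP[fpC1 fpC2].
split => pS K; have [[|n] Kn] := pS (K + Num.bound C)%N.
- by move: Kn; rewrite big_ord0 ltNge ler0n.
- exists n.+2; rewrite sumS; move: Kn; rewrite natrD => Kn.
  rewrite -ltrBlDl (le_lt_trans _ Kn)// lerD2l.
  by rewrite lerNl (le_trans _ fpC1)// lerN2.
- by move: Kn; rewrite big_ord0 ltNge ler0n.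
- exists n; move: Kn; rewrite sumS natrD -ltrBlDl; apply: le_lt_trans.
  by rewrite lerBrDr lerD2l (le_trans fpC2).
Qed.

(** The maximal ergodic theorem for f 1_U, where U is invariant: on U some partial
    sum of f is positive. *)
Lemma integral_unbounded_sums (P : probability X R) :
  (forall A, measurable A -> P (theta @^-1` A) = P A) ->
  (0 <= \int[P]_(p in unbounded_sums) (f p)%:E)%E.
Proof.
move=> theta_pres.
have mU := measurable_unbounded_sums.
rewrite -integral_mul_indic.
under eq_integral do rewrite -EFinM.
apply: (@maximal_ergodic R _ X P theta _ C) => //.
- by apply: measurable_funM.
- move=> p; rewrite normrM (le_trans _ (fC p))// ler_piMr//.
  by rewrite indicE; case: (_ \in _); rewrite ?normr1 ?normr0.
- move=> p fp; have [pU|pU] := pselect (unbounded_sums p); last first.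
    by move: fp; rewrite indicE memNset// mulr0 eqxx.
  have itU k : \1_unbounded_sums (iter k theta p) = 1 :> R.
    rewrite indicE mem_set//; elim: k => // k ih.
    exact/unbounded_sums_invariant.
  have [n Kn] := pU 0%N; exists n.
  by under eq_bigr do rewrite itU mulr1.
Qed.

End unbounded_sums.

(** * Setwise convergence of measures *)

Section setwise_convergence.
Local Open Scope ereal_scope.
Context (R : realType) d (T : measurableType d).
Context (mu_ : nat -> {measure set T -> \bar R}) (mu : {measure set T -> \bar R}).
Hypothesis mu_cvg : forall B, measurable B -> mu_ n B @[n --> \oo] --> mu B.

Import HBNNSimple.

Let cvg_integral_nnsfun (g : {nnsfun T >-> R}) :
  \int[mu_ n]_y (g y)%:E @[n --> \oo] --> \int[mu]_y (g y)%:E.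
Proof.
under eq_fun do rewrite integralT_nnsfun sintegralE fsbig_finite//.
rewrite integralT_nnsfun sintegralE fsbig_finite//=.
apply: cvg_nnesum => r _.
  by apply: nearW => n; exact: nnsfun_mulemu_ge0.
by apply: cvgeZl => //; apply: mu_cvg.
Qed.

(** Fatou's lemma for setwise convergence of measures. Applied to h and to 1 - h,
    for h with values in [0, 1], it identifies the limit of the integrals of h. *)
Lemma fatou_setwise (h : T -> \bar R) c :
  (forall y, 0 <= h y) -> measurable_fun setT h ->
  \int[mu_ n]_y h y @[n --> \oo] --> c -> \int[mu]_y h y <= c.
Proof.
move=> h0 mh hc.
pose f_ := nnsfun_approx measurableT mh.
have -> : \int[mu]_y h y = limn (fun k => \int[mu]_y (f_ k y)%:E).
  rewrite -monotone_convergence//.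
  - by apply: eq_integral => y _; apply/esym/cvg_lim => //; exact: cvg_nnsfun_approx.
  - by move=> n; exact/measurable_EFinP.
  - by move=> n y _; rewrite lee_fin.
  - by move=> y _ a b ab; rewrite lee_fin; exact/lefP/nd_nnsfun_approx.
apply: lime_le.
  apply: ereal_nondecreasing_is_cvgn => a b ab; apply: ge0_le_integral => //.
  - by move=> z _; rewrite lee_fin.
  - exact/measurable_EFinP.
  - exact/measurable_EFinP.
  - by move=> z _; rewrite lee_fin; exact/lefP/nd_nnsfun_approx.
apply: nearW => k.
rewrite -(cvg_lim _ (@cvg_integral_nnsfun (f_ k)))// -(cvg_lim _ hc)//.
apply: lee_lim.
- by apply/cvg_ex; eexists; exact: cvg_integral_nnsfun.
- by apply/cvg_ex; eexists; exact: hc.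
- apply: nearW => n; apply: ge0_le_integral => //.
  + by move=> z _; rewrite lee_fin.
  + exact/measurable_EFinP.
  + by move=> z _; rewrite nnsfun_approxE; apply: le_approx.
Qed.

End setwise_convergence.

Lemma tv_cvg_setwise (R : realType) d (T : measurableType d)
    (mu_ : nat -> probability T R) (mu : probability T R) :
  tv_dist (mu_ n) mu @[n --> \oo] --> 0%E ->
  forall B, measurable B -> mu_ n B @[n --> \oo] --> mu B.
Proof.
move=> tv0 B mB; apply/sube_cvg0.
  rewrite ge0_fin_numE//; exact: le_lt_trans (probability_le1 _ mB) (ltry _).
apply/cvg_abse0P.
apply: (@squeeze_cvge _ _ _ _ (cst 0%E) _ (fun n => tv_dist (mu_ n) mu)) => //.
- apply: nearW => n /=; rewrite abse_ge0/=.
  by apply: ereal_sup_ubound; exists B.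
- exact: cvg_cst.
Qed.

(** * Marked Markov chains and their path space *)

Lemma prod_indic (R : realType) (T : Type) n (A : nat -> set T) w :
  \prod_(j < n) \1_(A j) w = \1_(\bigcap_(j in `I_n) A j) w :> R.
Proof.
elim: n => [|n ih].
  by rewrite big_ord0 II0 bigcap_set0 indicE in_setT.
by rewrite big_ord_recr/= ih IIS bigcap_setU bigcap_set1 indicI.
Qed.

Section marked_chain.
Local Open Scope ereal_scope.
Context (R : realType) (dO d : measure_display).
Context (Omega : measurableType dO) (T : measurableType d).
Context (Q : R.-pker T ~> T) (s : T -> R).
Context (Z : nat -> {mfun Omega >-> T}) (J : nat -> set Omega).

(** A Markov chain Z with kernel Q in which, given the whole chain and the earlier
    marks, the mark J_n is present with probability s(Z_n). *)
Record marked_chain (P : probability Omega R) : Prop := {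
  mc_prob0 : forall y, (0 <= s y)%R ;
  mc_prob1 : forall y, (s y <= 1)%R ;
  mc_probm : measurable_fun setT s ;
  mc_markm : forall n, measurable (J n) ;
  mc_markov : forall n B, measurable B -> forall H, sigma_rvs `I_n.+1 Z H ->
    P (Z n.+1 @^-1` B `&` H) = \int[P]_(w in H) Q (Z n w) B ;
  mc_mark : forall n H,
    <<s sigma_rvs setT Z `|` [set J k | k in `I_n] >> H ->
    P (J n `&` H) = \int[P]_(w in H) (s (Z n w))%:E }.

(** In position j, a set to which the state must belong, and whether the mark is
    required; false leaves the mark free, so that the cylinders below are stable
    under intersection. *)
Definition cylinder_spec := (nat -> set T * bool)%type.

Definition slot_weight (b : set T * bool) (y : T) : R :=
  \1_(b.1) y * (if b.2 then s y else 1%R).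

(** The probability of the first n constraints for a marked chain started at y. *)
Fixpoint cylinder_prob (n : nat) (c : cylinder_spec) (y : T) : \bar R :=
  if n is n.+1 then
    (slot_weight (c 0%N) y)%:E * \int[Q y]_z cylinder_prob n (c \o succn) z
  else 1.

Definition marks (I : nat -> bool) (n : nat) : set Omega :=
  [set w | forall j, (j < n)%N -> I j -> J j w].

Definition mark_weight (I : nat -> bool) (n : nat) (w : Omega) : R :=
  \prod_(j < n) (if I j then s (Z j w) else 1%R).

Variable P : probability Omega R.
Hypothesis PP : marked_chain P.

Let s0 := mc_prob0 PP.
Let s1 := mc_prob1 PP.
Let ms := mc_probm PP.
Let mJ := mc_markm PP.

Lemma slot_weight_ge0 b y : (0 <= slot_weight b y)%R.
Proof. by rewrite /slot_weight mulr_ge0//; case: ifP. Qed.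

Lemma measurable_slot_weight b : measurable b.1 ->
  measurable_fun setT (slot_weight b).
Proof.
by case: b => B [] /= mB; apply: measurable_funM.
Qed.

Lemma ge0_mfun_cylinder_prob n c : (forall j, measurable (c j).1) ->
  ge0_mfun (cylinder_prob n c).
Proof.
elim: n c => [c _|n ih c mc] /=; first by split.
have [v0 mv] := ih (c \o succn) (fun j => mc j.+1).
split => [y|].
  by rewrite mule_ge0 ?lee_fin ?slot_weight_ge0//; exact: integral_ge0.
apply: emeasurable_funM.
  by apply/measurable_EFinP; exact: measurable_slot_weight.
apply: measurable_fun_integral_kernel => // U mU.
exact: measurable_kernel.
Qed.

Let past n : set (set Omega) := \bigcup_(i in `I_n) sigma_rv (Z i).

Let past_measurable n : <<s past n >> `<=` measurable.
Proof.
apply: smallest_sub; first exact: sigma_algebra_measurable.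
move=> A [i _ [B mB <-]]; exact: measurable_funP.
Qed.

Lemma measurable_past n i : (i < n)%N ->
  measurable_fun setT (Z i : g_sigma_algebraType (past n) -> T).
Proof.
by move=> i_n _ B mB; apply: sub_sigma_algebra; exists i => //; exists B.
Qed.

Let past_widen n m d' (T' : measurableType d') (f : Omega -> T') : (n <= m)%N ->
  measurable_fun setT (f : g_sigma_algebraType (past n) -> T') ->
  measurable_fun setT (f : g_sigma_algebraType (past m) -> T').
Proof.
move=> nm mf _ B mB.
have := mf measurableT B mB.
apply: smallest_sub; first exact: smallest_sigma_algebra.
move=> A [i /= ik UA]; apply: sub_sigma_algebra; exists i => //=.
exact: leq_trans nm.
Qed.

(** Conditioning on Z_0, ..., Z_m, then on Z_0, ..., Z_(m+1), and so on; the weight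
    a collects the factors that are already known. *)
Lemma chain_integral n (c : cylinder_spec) m (a : Omega -> R) :
  (forall j, measurable (c j).1) ->
  (forall w, (0 <= a w)%R) ->
  measurable_fun setT (a : g_sigma_algebraType (past m.+1) -> R) ->
  \int[P]_w (a w * \prod_(j < n) slot_weight (c j) (Z (m + j)%N w))%:E =
  \int[P]_w ((a w)%:E * cylinder_prob n c (Z m w)).
Proof.
elim: n c m a => [|n ih] c m a mc a0 ma.
  by apply: eq_integral => w _; rewrite big_ord0 mulr1 mule1.
pose a' w := (a w * slot_weight (c 0%N) (Z m w))%R.
have ma' : measurable_fun setT (a' : g_sigma_algebraType (past m.+1) -> R).
  apply: measurable_funM => //.
  apply: (@measurableT_comp _ _ _ _ _ _ (slot_weight (c 0%N))) => //.
    exact: measurable_slot_weight.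
  exact: measurable_past.
have a'0 w : (0 <= a' w)%R by rewrite mulr_ge0// slot_weight_ge0.
transitivity (\int[P]_w (a' w *
    \prod_(j < n) slot_weight ((c \o succn) j) (Z (m.+1 + j)%N w))%:E).
  apply: eq_integral => w _; rewrite big_ord_recl /= addn0 mulrA.
  by congr (_ * _)%:E; apply: eq_bigr => i _; rewrite addnS.
rewrite (ih (c \o succn) m.+1 a' (fun j => mc j.+1) a'0
  (@past_widen m.+1 m.+2 _ _ a' (leqnSn _) ma')).
rewrite (@cond_kernel_integral R dO Omega P (past m.+1) (@past_measurable _)
  _ _ Q (Z m) (Z m.+1) (measurable_funP _) (measurable_funP _)
  (fun B mB H GH => mc_markov PP mB GH) a'
  (cylinder_prob n (c \o succn)) a'0 ma'
  (@ge0_mfun_cylinder_prob n (c \o succn) (fun j => mc j.+1)))//.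
by apply: eq_integral => w _; rewrite /= EFinM muleA.
Qed.

Lemma marksE I n :
  marks I n = \bigcap_(j in `I_n) (if I j then J j else setT).
Proof.
apply/seteqP; split => [w h j jn|w h j jn Ij].
  by case: ifPn => // Ij; exact: h.
by have := h j jn; rewrite Ij.
Qed.

Lemma measurable_marks I n : measurable (marks I n).
Proof. by rewrite marksE; apply: bigcap_measurableType => j _; case: ifP. Qed.

Let allZ n := sigma_rvs setT Z `|` [set J k | k in `I_n].

Let allZ_measurable n : <<s allZ n >> `<=` measurable.
Proof.
apply: smallest_sub; first exact: sigma_algebra_measurable.
move=> A [|[k _ <-]//].
move: A; apply: smallest_sub; first exact: sigma_algebra_measurable.
by move=> A [i _ [B mB <-]]; exact: measurable_funP.
Qed.

Let chain_alg := g_sigma_algebraType (\bigcup_(i in setT) sigma_rv (Z i)).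

Lemma measurable_chain_alg i : measurable_fun setT (Z i : chain_alg -> T).
Proof.
by move=> _ B mB; apply: sub_sigma_algebra; exists i => //; exists B.
Qed.

(** The marks are integrated out from the last one to the first one: given the
    chain and the earlier marks, J_n is replaced by s(Z_n). *)
Lemma marks_integral I n (g : Omega -> \bar R) :
  ge0_mfun (g : chain_alg -> \bar R) ->
  \int[P]_(w in marks I n) g w = \int[P]_w ((mark_weight I n w)%:E * g w).
Proof.
elim: n g => [|n ih] g gP.
  rewrite (_ : marks I 0 = setT); last by apply/seteqP; split.
  by apply: eq_integral => w _; rewrite /mark_weight big_ord0 mul1e.
pose sI w := (if I n then s (Z n w) else 1)%R.
have sI0 w : (0 <= sI w)%R by rewrite /sI; case: ifP.
have msI : measurable_fun setT (sI : chain_alg -> R).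
  rewrite /sI; case: (I n) => //.
  exact: (measurableT_comp ms (@measurable_chain_alg n)).
have sIgP : ge0_mfun (fun w : chain_alg => (sI w)%:E * g w).
  by apply: ge0_mfunM => //; split => [w|]; [rewrite lee_fin|exact/measurable_EFinP].
transitivity (\int[P]_(w in marks I n) ((sI w)%:E * g w)); last first.
  rewrite ih//; apply: eq_integral => w _.
  by rewrite /mark_weight big_ord_recr/= EFinM -muleA.
rewrite -[LHS]integral_mul_indic -[RHS]integral_mul_indic.
have gmP : ge0_mfun (fun w : g_sigma_algebraType (allZ n) =>
    g w * (\1_(marks I n) w)%:E).
  have [g0 mg] := gP.
  apply: ge0_mfunM; last first.
    apply: ge0_mfun_indic; rewrite marksE.
    apply: bigcap_measurableType => j jn; case: ifP => _; last exact: measurableT.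
    by apply: sub_sigma_algebra; right; exists j.
  split => // _ B mB; have := mg measurableT B mB.
  apply: smallest_sub; first exact: smallest_sigma_algebra.
  move=> A UA; apply: sub_sigma_algebra; left.
  exact: sub_sigma_algebra.
rewrite /sI; case: (boolP (I n)) => In; last first.
  apply: eq_integral => w _; rewrite mul1e; congr (_ * (\1_ _ _)%:E).
  apply/seteqP; split => [v h j jn|v h j]; first by apply: h; exact: ltnW.
  by rewrite ltnS leq_eqVlt => /predU1P[->|]; [rewrite (negbTE In)|exact: h].
have := @cond_prob_integral R dO Omega P (allZ n) (@allZ_measurable n) (J n)
  (s \o Z n) (mJ n) (fun w => s0 _) (measurableT_comp ms (measurable_funP _))
  (fun H aH => mc_mark PP aH) _ gmP.
under [in X in _ = X -> _]eq_integral do rewrite /= muleA.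
move=> <-; apply: eq_integral => w _.
rewrite muleCA -EFinM; congr (_ * _%:E).
rewrite -[RHS]/((\1_(J n) \* \1_(marks I n)) w)%R -indicI; congr (\1_ _ _).
apply/seteqP; split => [v h|v [hJ h] j].
  by split; [exact: h|move=> j jn; apply: h; exact: ltnW].
by rewrite ltnS leq_eqVlt => /predU1P[->|]; [|exact: h].
Qed.

Definition path := (nat -> T * bool)%type.

Definition cylinder (c : cylinder_spec) : set path :=
  [set p : path | forall j, (c j).1 (p j).1 /\ ((c j).2 -> (p j).2)].

Definition finite_cylinder_spec (n : nat) (c : cylinder_spec) : Prop :=
  (forall j, measurable (c j).1) /\
  (forall j, (n <= j)%N -> c j = (setT, false)).

Definition cylinders : set (set path) :=
  [set C | exists n c, finite_cylinder_spec n c /\ C = cylinder c].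

Definition path_space := g_sigma_algebraType cylinders.

Definition trajectory (m : nat) (w : Omega) : path_space :=
  fun j => (Z (m + j)%N w, w \in J (m + j)%N).

(** The event G0 and the marks before time m stand for the past. The marks are all
    integrated out, which leaves an expectation over Z alone; the Markov property
    of Z applies to it, and the marks of the past are then put back. *)
Lemma cylinder_markov m (G0 : set Omega) I n c :
  <<s past m.+1 >> G0 -> finite_cylinder_spec n c ->
  P ((G0 `&` marks I m) `&` (trajectory m @^-1` (cylinder c))) =
  \int[P]_(w in G0 `&` marks I m) cylinder_prob n c (Z m w).
Proof.
move=> pG0 [mc cT].
have mG0 : measurable G0 by exact: (past_measurable pG0).
(* the marks required by the past and by the cylinder shifted by m *)
pose I' j := if (j < m)%N then I j else (c (j - m)%N).2.
pose E1 := \bigcap_(j in `I_n) (Z (m + j)%N @^-1` (c j).1).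
have mE1 : measurable E1.
  apply: bigcap_measurableType => j _; exact: measurable_funPTI.
have -> : (G0 `&` marks I m) `&` (trajectory m @^-1` (cylinder c)) =
    (G0 `&` E1) `&` marks I' (m + n).
  apply/seteqP; split => w /=.
    move=> [[G0w Iw] cw]; split; [split => // j _|].
      by have [] := cw j.
    move=> j jmn; rewrite /I'; case: ifPn => [jm|]; first exact: Iw.
    rewrite -leqNgt => mj cj; have [_ /(_ cj)] := cw (j - m)%N.
    by rewrite /trajectory/= subnKC// inE.
  move=> [[G0w E1w] Iw]; split; [split => // j jm Ij|move=> j].
    by apply: Iw; [exact: ltn_addr|rewrite /I' jm].
  have [jn|nj] := ltnP j n; last by rewrite cT.
  split; first exact: E1w.
  move=> cj; rewrite /trajectory/= inE; apply: Iw; first by rewrite ltn_add2l.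
  by rewrite /I' ltnNge leq_addr/= addKn.
have past_chain (f : Omega -> R) :
    measurable_fun setT (f : g_sigma_algebraType (past m.+1) -> R) ->
    measurable_fun setT (f : chain_alg -> R).
  move=> mf _ B mB; have := mf measurableT B mB.
  apply: smallest_sub; first exact: smallest_sigma_algebra.
  by move=> A [i _ UA]; apply: sub_sigma_algebra; exists i.
have m1G0 : measurable_fun setT (\1_G0 : g_sigma_algebraType (past m.+1) -> R).
  exact: measurable_indic.
have m1G0c : measurable_fun setT (\1_G0 : chain_alg -> R) by exact: past_chain m1G0.
have Zge0 (f : T -> \bar R) : ge0_mfun f ->
    ge0_mfun (fun w : chain_alg => (\1_G0 w)%:E * f (Z m w)).
  move=> fP; apply: ge0_mfunM; last first.
    exact: (ge0_mfun_comp (@measurable_chain_alg m) fP).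
  split => [w|]; first by rewrite lee_fin.
  by apply/measurable_EFinP; exact: m1G0c.
have mE1c : measurable (E1 : set chain_alg).
  apply: bigcap_measurableType => j _.
  rewrite -[X in measurable X]setTI.
  exact: (@measurable_chain_alg (m + j)%N).
have -> : P (G0 `&` E1 `&` marks I' (m + n)) =
    \int[P]_(w in marks I' (m + n)) ((\1_G0 w * \1_E1 w)%:E).
  rewrite -integral_indic; last 2 first.
  - exact: measurable_marks.
  - exact: measurableI.
  by apply: eq_integral => w _; rewrite indicI.
rewrite marks_integral; last first.
  split => [w|]; first by rewrite lee_fin mulr_ge0.
  apply/measurable_EFinP; apply: measurable_funM; first exact: m1G0c.
  exact: measurable_indic.
pose a w := (\1_G0 w * mark_weight I m w)%R.
have a0 w : (0 <= a w)%R.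
  by rewrite mulr_ge0// prodr_ge0// => j _; case: ifP.
have ma : measurable_fun setT (a : g_sigma_algebraType (past m.+1) -> R).
  apply: measurable_funM => //.
  apply: measurable_prod => j _; case: (I j) => //.
  apply: (measurableT_comp ms).
  by apply: measurable_past; rewrite ltnS ltnW.
transitivity (\int[P]_w
    (a w * \prod_(j < n) slot_weight (c j) (Z (m + j)%N w))%:E).
  apply: eq_integral => w _; rewrite -EFinM; congr _%:E.
  rewrite /slot_weight big_split/= (prod_indic R n (fun j => Z (m + j)%N @^-1` (c j).1)).
  rewrite /a mulrACA mulrC; congr (_ * _)%R.
  rewrite /mark_weight big_split_ord/=; congr (_ * _)%R.
    by apply: eq_bigr => j _; rewrite /I' ltn_ord.
  by apply: eq_bigr => j _; rewrite /I' ltnNge leq_addr/= addKn.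
rewrite chain_integral//.
have vP := ge0_mfun_cylinder_prob n mc.
transitivity (\int[P]_w ((mark_weight I m w)%:E *
    ((\1_G0 w)%:E * cylinder_prob n c (Z m w)))).
  by apply: eq_integral => w _; rewrite /a mulrC EFinM muleA.
rewrite -marks_integral; last exact: Zge0.
rewrite setIC integral_mkcondr; apply: eq_integral => w _.
by rewrite patchE indicE; case: ifPn => wC; rewrite /= ?mul1e ?mul0e.
Qed.

End marked_chain.
Arguments cylinders {d} T.

Section path_law.
Local Open Scope ereal_scope.
Context (R : realType) (dO d : measure_display).
Context (Omega : measurableType dO) (T : measurableType d).
Context (Q : R.-pker T ~> T) (s : T -> R).
Context (Z : nat -> {mfun Omega >-> T}) (J : nat -> set Omega).
Context (Pr : probability T R -> probability Omega R).
Hypothesis PrP : forall mu, marked_chain Q s Z J (Pr mu).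
Hypothesis Pr_init : forall mu B, measurable B -> Pr mu (Z 0%N @^-1` B) = mu B.

Let mJ n : measurable (J n). Proof. exact: (mc_markm (PrP (dirac point))). Qed.

Lemma measurable_trajectory m :
  measurable_fun setT (trajectory Z J m : Omega -> path_space T).
Proof.
have mb := (@measurability _ _ Omega (path_space T) setT (trajectory Z J m) (cylinders T)).
apply: mb => //.
move=> _ [_ [n [c [[mc _] ->]] <-]]; rewrite setTI.
rewrite (_ : _ @^-1` _ = \bigcap_j
    ((Z (m + j)%N @^-1` (c j).1) `&` (if (c j).2 then J (m + j)%N else setT))).
  apply: bigcap_measurableType => j _; apply: measurableI.
    exact: measurable_funPTI.
  by case: ifP.
apply/seteqP; split => [w cw j _|w cw j].
  have [c1 c2] := cw j; split => //; case: ifPn => // cj.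
  by have := c2 cj; rewrite /trajectory/= inE.
have [c1] := cw j Logic.I; split => // cj; move: b; rewrite cj.
by rewrite /trajectory/= inE.
Qed.

Lemma setI_closed_cylinders : setI_closed (cylinders T).
Proof.
move=> _ _ [n [c [[mc cT] ->]]] [n' [c' [[mc' cT'] ->]]].
exists (maxn n n'), (fun j => ((c j).1 `&` (c' j).1, (c j).2 || (c' j).2)).
split; first split => [j|j]; first exact: measurableI.
  by rewrite geq_max => /andP[nj n'j]; rewrite cT// cT'//= setTI.
apply/seteqP; split => [p [cp cp'] j|p ccp].
  have [c1 c2] := cp j; have [c1' c2'] := cp' j.
  by split => //= /orP[].
by split => j; have [/= [c1 c1'] cc] := ccp j; split => // cj; apply: cc;
  rewrite cj ?orbT.
Qed.

Definition path_kernel (y : T) (A : set (path_space T)) : \bar R :=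
  Pr (dirac y) (trajectory Z J 0 @^-1` A).

Let measurable_traj m (A : set (path_space T)) : measurable A ->
  measurable (trajectory Z J m @^-1` A).
Proof.
by move=> mA; rewrite -[X in measurable X]setTI; exact: measurable_trajectory.
Qed.

Lemma path_kernel_ge0 y A : 0 <= path_kernel y A.
Proof. exact: measure_ge0. Qed.

Lemma path_kernel_le1 y (A : set (path_space T)) : measurable A -> path_kernel y A <= 1.
Proof. by move=> mA; apply: probability_le1; exact: measurable_traj. Qed.

Lemma path_kernel_cylinder n c y : finite_cylinder_spec n c ->
  path_kernel y (cylinder c) = cylinder_prob Q s n c y.
Proof.
move=> cP; rewrite /path_kernel.
have mc := cP.1.
have := @cylinder_markov _ _ _ _ _ _ _ _ _ _ (PrP (dirac y)) 0 setT
  (fun=> false) n c _ cP.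
have -> : setT `&` marks J (fun=> false) 0 = setT.
  by apply/seteqP; split => // w _; split => // j.
rewrite setTI => ->; last first.
  exact: (@measurableT _ (g_sigma_algebraType (\bigcup_(i in `I_1) sigma_rv (Z i)))).
have [v0 mv] := ge0_mfun_cylinder_prob (PrP (dirac y)) n mc.
rewrite -[LHS](@ge0_integral_pushforward _ _ _ _ _ (Z 0%N) _ _ setT)//.
rewrite (eq_measure_integral (dirac y)); last first.
  by move=> A mA _; exact: Pr_init.
by rewrite integral_dirac// diracT mul1e.
Qed.

(** The Markov property of the marked chain. Both statements pass from cylinders to
    all events because the latter form the smallest Dynkin system containing
    the former. *)
Lemma path_markov (A : set (path_space T)) : measurable A ->
  measurable_fun setT (path_kernel ^~ A) /\
  forall mu m G0 I, sigma_rvs `I_m.+1 Z G0 ->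
  Pr mu ((G0 `&` marks J I m) `&` (trajectory Z J m @^-1` A)) =
  \int[Pr mu]_(w in G0 `&` marks J I m) path_kernel (Z m w) A.
Proof.
have mH (mu : probability T R) m G0 I : sigma_rvs `I_m.+1 Z G0 ->
    measurable (G0 `&` marks J I m).
  move=> pG0; apply: measurableI; last exact: (measurable_marks (PrP mu)).
  move: G0 pG0; apply: smallest_sub; first exact: sigma_algebra_measurable.
  by move=> ? [i _ [B mB <-]]; exact: measurable_funP.
pose D (A : set (path_space T)) := measurable_fun setT (path_kernel ^~ A) /\
  forall (mu : probability T R) m G0 I, sigma_rvs `I_m.+1 Z G0 ->
  Pr mu ((G0 `&` marks J I m) `&` (trajectory Z J m @^-1` A)) =
  \int[Pr mu]_(w in G0 `&` marks J I m) path_kernel (Z m w) A.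
move: A; apply: (@dynkin_induction _ (path_space T) (cylinders T) D) => //; rewrite /D.
- exact: setI_closed_cylinders.
- split => [|mu m G0 I pG0].
    under eq_fun do rewrite /path_kernel preimage_setT probability_setT.
    exact: measurable_cst.
  rewrite preimage_setT setIT.
  under eq_integral do rewrite /path_kernel preimage_setT probability_setT.
  by rewrite integral_cst ?mul1e//; exact: mH.
- move=> _ [n [c [cP ->]]]; split => [|mu m G0 I pG0].
    under eq_fun do rewrite (path_kernel_cylinder _ cP).
    by have [] := ge0_mfun_cylinder_prob (PrP (dirac point)) n cP.1.
  under eq_integral do rewrite (path_kernel_cylinder _ cP).
  exact: (cylinder_markov (PrP mu)).
- move=> A mA [mk AP].
  have kC y : path_kernel y (~` A) = 1 - path_kernel y A.
    rewrite /path_kernel preimage_setC probability_setC//.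
    exact: measurable_traj.
  split => [|mu m G0 I pG0].
    under eq_fun do rewrite kC.
    exact: emeasurable_funB.
  have := AP mu m G0 I pG0; have := mH mu m G0 I pG0.
  move: (_ `&` marks _ _ _) => H mHw PHA.
  have mkZ : measurable_fun H (fun w => path_kernel (Z m w) A).
    by apply: measurable_funTS; exact: (measurableT_comp mk).
  have k0 w : 0 <= 1 - path_kernel (Z m w) A.
    by rewrite sube_ge0 ?path_kernel_le1//= orbT.
  have PH : Pr mu H = \int[Pr mu]_(w in H) (1 - path_kernel (Z m w) A) +
      \int[Pr mu]_(w in H) path_kernel (Z m w) A.
    rewrite -ge0_integralD//=; last first.
      by apply: emeasurable_funB.
    under eq_integral.
      move=> w _; rewrite subeK; last first.
        rewrite ge0_fin_numE ?path_kernel_ge0//.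
        exact: le_lt_trans (path_kernel_le1 _ mA) (ltry _).
      over.
    by rewrite integral_cst// mul1e.
  under eq_integral do rewrite kC.
  have mE := measurable_traj m mA.
  rewrite preimage_setC -setDE.
  have -> : Pr mu (H `\` (trajectory Z J m @^-1` A)) =
      Pr mu H - Pr mu (H `&` (trajectory Z J m @^-1` A)).
    apply: measureD => //.
    exact: le_lt_trans (probability_le1 _ mHw) (ltry _).
  rewrite PHA PH addeK// -PHA ge0_fin_numE//.
  apply: le_lt_trans (probability_le1 _ _) (ltry _).
  by apply: measurableI => //; exact: measurable_traj.
- move=> F mF tF FP.
  have kU y : path_kernel y (\bigcup_k F k) = \sum_(k <oo) path_kernel y (F k).
    rewrite /path_kernel preimage_bigcup measure_bigcup//.
    - by apply: eq_eseriesl => k; rewrite in_setT.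
    - by move=> k _; exact: measurable_traj.
    - apply/trivIsetP => i j _ _ ij; rewrite -preimage_setI.
      by have /trivIsetP/(_ i j Logic.I Logic.I ij) -> := tF; rewrite preimage_set0.
  split => [|mu m G0 I pG0].
    under eq_fun do rewrite kU.
    by apply: ge0_emeasurable_sum => // k _; case: (FP k).
  under eq_integral do rewrite kU.
  have := mH mu m G0 I pG0.
  have := fun k => (FP k).2 mu m G0 I pG0.
  move: (_ `&` marks _ _ _) => H FPH mHw.
  rewrite integral_nneseries//; last first.
    move=> k; apply: measurable_funTS; exact: (measurableT_comp (FP k).1).
  rewrite preimage_bigcup setI_bigcupr measure_bigcup//; last 2 first.
  - by move=> k _; apply: measurableI => //; exact: measurable_traj.
  - apply: trivIset_setIl; apply/trivIsetP => i j _ _ ij; rewrite -preimage_setI.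
    by have /trivIsetP/(_ i j Logic.I Logic.I ij) -> := tF; rewrite preimage_set0.
  rewrite (@eq_eseriesl _ _ predT); last by move=> k; rewrite in_setT.
  by apply: eq_eseriesr => k _; rewrite -FPH.
Qed.

End path_law.

(** * Ergodicity of marked chains *)

Section shift.
Context (d : measure_display) (T : measurableType d).

Definition shift (p : path_space T) : path_space T := fun j => p j.+1.

Lemma iter_shift n p : iter n shift p 0%N = p n.
Proof.
have h m : iter n shift p m = p (n + m)%N.
  by elim: n m => // n ih m; rewrite iterS /shift ih addnS addSn.
by rewrite h addn0.
Qed.

Lemma measurable_shift : measurable_fun setT shift.
Proof.
have mb := @measurability _ _ (path_space T) (path_space T) setT shift (cylinders T).
apply: mb => //.
move=> _ [_ [n [c [[mc cT] ->]]] <-]; rewrite setTI; apply: sub_sigma_algebra.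
exists n.+1, (fun j => if j is j.+1 then c j else (setT, false)).
split; first by split => -[|j] //=; move=> nj; exact: cT.
apply/seteqP; split => [p cp [|j]//|p cp j]; exact: (cp j.+1).
Qed.

Lemma measurable_head_state : measurable_fun setT (fun p : path_space T => (p 0%N).1).
Proof.
move=> _ B mB; rewrite setTI; apply: sub_sigma_algebra.
exists 1%N, (fun j => if j is 0%N then (B, false) else (setT, false)).
split; first by split => -[|j] /=.
apply/seteqP; split => [p Bp [|j]//|p cp]; by have [] := cp 0%N.
Qed.

Lemma measurable_head_mark : measurable [set p : path_space T | (p 0%N).2].
Proof.
apply: sub_sigma_algebra.
exists 1%N, (fun j => if j is 0%N then (setT, true) else (setT, false)).
split; first by split => -[|j] /=.
apply/seteqP; split => [p Bp [|j]//|p cp]; have [_] := cp 0%N; exact.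
Qed.

End shift.

Section ergodic.
Local Open Scope ereal_scope.
Context (R : realType) (dO d : measure_display).
Context (Omega : measurableType dO) (T : measurableType d).
Context (Q : R.-pker T ~> T) (s : T -> R).
Context (Z : nat -> {mfun Omega >-> T}) (J : nat -> set Omega).
Context (Pr : probability T R -> probability Omega R).
Hypothesis PrP : forall mu, marked_chain Q s Z J (Pr mu).
Hypothesis Pr_init : forall mu B, measurable B -> Pr mu (Z 0%N @^-1` B) = mu B.
Context (nu : probability T R).
Hypothesis Pr_cvg : forall x B, measurable B ->
  Pr (dirac x) (Z n @^-1` B) @[n --> \oo] --> nu B.

Let traj m := trajectory Z J m.
Let kappa := path_kernel Z J Pr.

Let mtraj m : measurable_fun setT (traj m : Omega -> path_space T).
Proof. exact: measurable_trajectory. Qed.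

Let mtrajP m (A : set (path_space T)) : measurable A -> measurable (traj m @^-1` A).
Proof. by move=> mA; rewrite -[X in measurable X]setTI; exact: mtraj. Qed.

Let trajS m w : traj m.+1 w = shift (traj m w).
Proof. by apply/funext => j; rewrite /traj /shift /trajectory addSnnS. Qed.

Let mZ n B : measurable B -> measurable (Z n @^-1` B).
Proof. by move=> mB; exact: measurable_funPTI. Qed.

Let integral_Z (P : probability Omega R) n (f : T -> \bar R) :
  (forall y, 0 <= f y) -> measurable_fun setT f ->
  \int[distribution P (Z n)]_y f y = \int[P]_w f (Z n w).
Proof.
by move=> f0 mf; rewrite ge0_integral_distribution.
Qed.

Let kernel_ge0 B y : 0 <= Q y B. Proof. exact: measure_ge0. Qed.

Let markov_step mu n B : measurable B ->
  Pr mu (Z n.+1 @^-1` B) = \int[Pr mu]_w Q (Z n w) B.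
Proof.
move=> mB; have := mc_markov (PrP mu) mB (n := n) (H := setT).
rewrite setIT; apply.
exact: (@measurableT _ (g_sigma_algebraType (\bigcup_(i in `I_n.+1) sigma_rv (Z i)))).
Qed.

Let invariant_le B : measurable B -> \int[nu]_y Q y B <= nu B.
Proof.
move=> mB.
apply: (@fatou_setwise _ _ _ (fun n => distribution (Pr (dirac point)) (Z n)) nu).
- by move=> C mC; exact: Pr_cvg.
- by move=> y.
- exact: measurable_kernel.
- under eq_fun do
    rewrite (integral_Z _ _ (kernel_ge0 B) (measurable_kernel Q B mB)) -markov_step//.
  by have := Pr_cvg point mB; rewrite -cvg_shiftS.
Qed.

(* bounding the integrals of h and of its complement 1 - h forces equality *)
Let le_compl_eq (h h' : T -> \bar R) (c : \bar R) :
  (forall y, 0 <= h y) -> (forall y, 0 <= h' y) ->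
  measurable_fun setT h -> measurable_fun setT h' ->
  (forall y, h y + h' y = 1) -> 0 <= c -> c <= 1 ->
  \int[nu]_y h y <= c -> \int[nu]_y h' y <= 1 - c -> \int[nu]_y h y = c.
Proof.
move=> h0 h'0 mh mh' hh' c0 c1 hc h'c.
apply/eqP; rewrite eq_le hc/=.
have : \int[nu]_y h y + \int[nu]_y h' y = 1.
  rewrite -ge0_integralD//; under eq_integral do rewrite hh'.
  by rewrite integral_cst// mul1e; exact: probability_setT.
have c_fin : c \is a fin_num by rewrite ge0_fin_numE// (le_lt_trans c1)// ltry.
move: h'c (integral_ge0 nu (fun y (_ : setT y) => h'0 y)).
rewrite -(fineK c_fin) -EFinB.
case: (\int[nu]_y h' y) => [r| |]; rewrite ?leeNy_eq// ?leye_eq//.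
case: (\int[nu]_y h y) => //= q; rewrite !lee_fin.
by move=> rc r0 [qr]; lra.
Qed.

(** nu(B) is the limit of P(Z_(n+1) in B), the integral of Q(., B) against the law
    of Z_n. *)
Lemma invariant_measure B : measurable B -> \int[nu]_y Q y B = nu B.
Proof.
move=> mB; apply: (le_compl_eq (h' := fun y => Q y (~` B))) => //.
- exact: measurable_kernel.
- by apply: measurable_kernel; exact: measurableC.
- move=> y; rewrite -(measureU (Q y) mB (measurableC mB)) ?setICr// setUv.
  exact: prob_kernel.
- exact: probability_le1.
- exact: invariant_le.
- by rewrite -probability_setC//; apply: invariant_le; exact: measurableC.
Qed.


Let kappa_m (A : set (path_space T)) : measurable A ->
  measurable_fun setT (kappa ^~ A).
Proof. by move=> mA; have [] := path_markov PrP Pr_init mA. Qed.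

Let kappa0 (A : set (path_space T)) y : 0 <= kappa y A.
Proof. exact: path_kernel_ge0. Qed.

Let trajectory_law mu m (A : set (path_space T)) : measurable A ->
  Pr mu (traj m @^-1` A) = \int[Pr mu]_w kappa (Z m w) A.
Proof.
move=> mA; have [_ /(_ mu m setT (fun=> false))] := path_markov PrP Pr_init mA.
have -> : setT `&` marks J (fun=> false) m = setT.
  by apply/seteqP; split => // w _; split => // j.
rewrite setTI; apply.
exact: (@measurableT _ (g_sigma_algebraType (\bigcup_(i in `I_m.+1) sigma_rv (Z i)))).
Qed.

Let Z1_law B : measurable B -> Pr nu (Z 1%N @^-1` B) = nu B.
Proof.
move=> mB; rewrite markov_step// -[RHS]invariant_measure//.
rewrite -(integral_Z _ _ (kernel_ge0 B) (measurable_kernel Q B mB)).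
by apply: eq_measure_integral => C mC _; exact: Pr_init.
Qed.

Lemma stationary_path (A : set (path_space T)) : measurable A ->
  Pr nu (traj 1 @^-1` A) = Pr nu (traj 0 @^-1` A).
Proof.
move=> mA; rewrite !trajectory_law//.
rewrite -!(integral_Z _ _ (kappa0 A) (kappa_m mA)).
by apply: eq_measure_integral => C mC _; exact: etrans (Z1_law mC) (esym (Pr_init _ mC)).
Qed.

Section invariant_event.
Variable A : set (path_space T).
Hypothesis mA : measurable A.
Hypothesis shiftA : forall p, A (shift p) <-> A p.

Let trajA m : traj m @^-1` A = traj 0 @^-1` A.
Proof.
elim: m => // m <-; apply/seteqP; split => w; rewrite /preimage/= trajS;
  by have [h1 h2] := shiftA (traj m w).
Qed.

(** kappa y A = P_y(the path shifted by m is in A) is the mean of kappa(., A) under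
    the law of Z_m, which converges to nu as m grows. *)
Lemma path_kernel_invariant y : kappa y A = Pr nu (traj 0 @^-1` A).
Proof.
have kle (B : set (path_space T)) : measurable B ->
    (forall m, traj m @^-1` B = traj 0 @^-1` B) ->
    \int[nu]_z kappa z B <= kappa y B.
  move=> mB trajB.
  apply: (@fatou_setwise _ _ _ (fun n => distribution (Pr (dirac y)) (Z n)) nu).
  - by move=> C mC; exact: Pr_cvg.
  - by move=> z.
  - exact: kappa_m.
  - apply: cvg_near_cst; apply: nearW => n.
    by rewrite (integral_Z _ _ (kappa0 B) (kappa_m mB)) -trajectory_law// trajB.
rewrite trajectory_law// -(integral_Z _ _ (kappa0 A) (kappa_m mA)).
rewrite (eq_measure_integral nu); last by move=> C mC _; exact: Pr_init.
have kC z : kappa z (~` A) = 1 - kappa z A.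
  by rewrite /kappa /path_kernel preimage_setC probability_setC//; exact: mtrajP.
apply/esym/(le_compl_eq (h' := fun z => kappa z (~` A))) => //.
- exact: kappa_m.
- by apply: kappa_m; exact: measurableC.
- move=> z; rewrite kC addeC subeK// ge0_fin_numE//.
  by apply: le_lt_trans (ltry 1); exact: path_kernel_le1.
- exact: path_kernel_le1.
- exact: kle.
- rewrite -kC; apply: kle; first exact: measurableC.
  by move=> m; exact: (congr1 setC (trajA m)).
Qed.

(** Seen as an event about the path from time 1 on, A has conditional probability
    kappa(Z_1, A), a constant. *)
Lemma independent_head B : measurable B ->
  Pr nu (Z 0%N @^-1` B `&` J 0%N `&` traj 0 @^-1` A) =
  Pr nu (traj 0 @^-1` A) * \int[nu]_(y in B) (s y)%:E.
Proof.
move=> mB; have [_ /(_ nu 1%N (Z 0%N @^-1` B) (fun=> true))] := path_markov PrP Pr_init mA.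
have -> : marks J (fun=> true) 1 = J 0%N.
  by apply/seteqP; split => [w /(_ 0%N)|w Jw [|]//]; exact.
rewrite -/(traj 1) trajA => ->; last first.
  apply: sub_sigma_algebra; exists 0%N => //; exists B => //.
  by rewrite setTI.
have ms := mc_probm (PrP nu).
have s0 := mc_prob0 (PrP nu).
rewrite (eq_integral (cst (Pr nu (traj 0 @^-1` A)))); last first.
  by move=> w _; exact: path_kernel_invariant.
rewrite integral_cst; last first.
  by apply: measurableI; [exact: mZ|exact: (mc_markm (PrP nu))].
congr (_ * _).
transitivity (Pr nu (J 0%N `&` (Z 0%N @^-1` B))); first by congr (Pr nu _); rewrite setIC.
rewrite (mc_mark (PrP nu) (n := 0%N) (H := Z 0%N @^-1` B)); last first.
  apply: sub_sigma_algebra; left; apply: sub_sigma_algebra.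
  by exists 0%N => //; exists B => //; rewrite setTI.
rewrite -integral_mul_indic -[RHS]integral_mul_indic.
pose g y := ((s y)%:E * (\1_B y)%:E).
have g0 y : 0 <= g y by rewrite mule_ge0// lee_fin.
have mg : measurable_fun setT g.
  by apply: emeasurable_funM; apply/measurable_EFinP.
rewrite -[LHS](integral_Z (Pr nu) 0 g0 mg).
by apply: eq_measure_integral => C mC _; exact: Pr_init.
Qed.

End invariant_event.

Section bounded_sums.
Context (a : T -> R) (c K : R).
Hypothesis ma : measurable_fun setT a.
Hypothesis aK : forall y, (`|a y| <= K)%R.
Hypothesis mean_neg : \int[nu]_y (s y * a y)%:E + c%:E < 0.

Let K0 : (0 <= K)%R. Proof. exact: le_trans (normr_ge0 _) (aK point). Qed.

Let f (p : path_space T) : R := (a (p 0%N).1 * ((p 0%N).2)%:R + c)%R.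

Let mf : measurable_fun setT f.
Proof.
apply: measurable_funD => //; apply: measurable_funM.
  exact: (measurableT_comp ma (@measurable_head_state d T)).
rewrite (_ : (fun _ => _) = \1_[set p : path_space T | (p 0%N).2]).
  by apply: measurable_indic; exact: measurable_head_mark.
by apply/funext => p; rewrite indicE mem_setE.
Qed.

Let fC p : (`|f p| <= K + `|c|)%R.
Proof.
rewrite /f (le_trans (ler_normD _ _))// lerD2r.
by case: (p 0%N).2; rewrite ?mulr1 ?mulr0 ?normr0.
Qed.

Let U := unbounded_sums (@shift d T) f.
Let mU : measurable U.
Proof. by apply: measurable_unbounded_sums => //; exact: measurable_shift. Qed.
Let shiftU p : U (shift p) <-> U p.
Proof. exact: (unbounded_sums_invariant _ fC). Qed.

Let U' := traj 0 @^-1` U.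
Let mU' : measurable U'. Proof. exact: mtrajP. Qed.
Let D := J 0%N `&` U'.
Let mD : measurable D.
Proof. by apply: measurableI => //; exact: (mc_markm (PrP nu)). Qed.
Let r := fine (Pr nu U').

Let rE : Pr nu U' = r%:E.
Proof.
rewrite /r fineK// ge0_fin_numE//.
exact: le_lt_trans (probability_le1 _ mU') (ltry _).
Qed.

Let r0 : (0 <= r)%R. Proof. exact: fine_ge0. Qed.
Let ms := mc_probm (PrP nu).
Let s0 := mc_prob0 (PrP nu).
Let s1 := mc_prob1 (PrP nu).

Let head_integral_ge0 (g : T -> \bar R) : ge0_mfun g ->
  \int[Pr nu]_w ((\1_D w)%:E * g (Z 0%N w)) = \int[nu]_y ((r * s y)%:E * g y).
Proof.
apply: (@eq_pos_functional R _ T (fun g => \int[Pr nu]_w ((\1_D w)%:E * g (Z 0%N w)))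
   (fun g => \int[nu]_y ((r * s y)%:E * g y))) => [||B mB].
- apply: (@pos_functional_integral R _ _ Omega T (Pr nu) \1_D (fun g => g \o Z 0%N)) => //.
  + by move=> h hP; exact: ge0_mfun_comp.
  + by move=> w; exact: pos_functional_eval.
- apply: (@pos_functional_integral R _ _ T T nu (fun y => r * s y)%R (fun g => g)) => //.
  + by move=> y; rewrite mulr_ge0.
  + exact: measurable_funM.
- rewrite [RHS]integral_mul_indic.
  under [RHS]eq_integral do rewrite EFinM.
  rewrite ge0_integralZl//; last 2 first.
  + by apply/measurable_EFinP; exact: measurable_funTS.
  + by move=> y _; rewrite lee_fin.
  rewrite -rE -independent_head//.
  rewrite -[X in _ = Pr nu X]setIT -[RHS]integral_indic//; last first.
    apply: measurableI => //; apply: measurableI; first exact: mZ.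
    exact: (mc_markm (PrP nu)).
  apply: eq_integral => w _; rewrite /= -EFinM; congr _%:E.
  have -> : Z 0%N @^-1` B `&` J 0%N `&` traj 0 @^-1` U = D `&` (Z 0%N @^-1` B).
    by rewrite -setIA setIC.
  by rewrite indicI.
Qed.

(* The shift by K reduces the bounded function a to nonnegative ones. *)
Let head_integral :
  \int[Pr nu]_w (\1_D w * a (Z 0%N w))%:E = r%:E * \int[nu]_y (s y * a y)%:E.
Proof.
have int_Z (h : T -> R) L : measurable_fun setT h -> (forall y, `|h y| <= L)%R ->
    (Pr nu).-integrable setT (EFin \o (fun w => \1_D w * h (Z 0%N w))%R).
  move=> mh hL; apply: (@probability_bounded_integrable _ _ _ _ _ L).
    by apply: measurable_funM => //; exact: measurableT_comp.
  move=> w; rewrite normrM (le_trans _ (hL (Z 0%N w)))// ler_piMl//.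
  by rewrite indicE; case: (_ \in _); rewrite ?normr1 ?normr0.
have int_s (h : T -> R) L : measurable_fun setT h -> (forall y, `|h y| <= L)%R ->
    nu.-integrable setT (EFin \o (fun y => r * s y * h y)%R).
  move=> mh hL; apply: (@probability_bounded_integrable _ _ _ _ _ (r * L)).
    by apply: measurable_funM => //; exact: measurable_funM.
  move=> y; rewrite normrM ger0_norm ?mulr_ge0// -mulrA ler_wpM2l//.
  by rewrite (le_trans _ (hL y))// ler_piMl.
pose a1 y := (a y + K)%R.
have a1K y : (`|a1 y| <= K + K)%R.
  by rewrite (le_trans (ler_normD _ _))// (ger0_norm K0) lerD2r.
have a10 y : (0 <= a1 y)%R.
  by rewrite /a1; have := aK y; rewrite ler_norml => /andP[+ _]; lra.
have ma1 : measurable_fun setT a1 by exact: measurable_funD.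
have mK : measurable_fun setT (cst K : T -> R) by exact: measurable_cst.
have KK (y : T) : (`|K| <= K)%R by rewrite ger0_norm.
have h1 := @head_integral_ge0 (EFin \o a1).
have h2 := @head_integral_ge0 (fun=> K%:E).
transitivity (\int[Pr nu]_w ((\1_D w * a1 (Z 0%N w))%:E - (\1_D w * K)%:E)).
  by apply: eq_integral => w _; rewrite -EFinB /a1; congr _%:E; ring.
rewrite integralB_EFin//; last 2 first.
- exact: int_Z a1K.
- exact: (int_Z (cst K) K mK KK).
transitivity (\int[nu]_y ((r * s y * a1 y)%:E - (r * s y * K)%:E)).
  rewrite integralB_EFin//; last 2 first.
  - exact: int_s a1K.
  - exact: (int_s (cst K) K mK KK).
  congr (_ - _); [apply: h1|apply: h2].
  + by split => [y|]; [rewrite lee_fin|exact/measurable_EFinP].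
  + by split => [y|]; [rewrite lee_fin|].
rewrite -integralZl//; last first.
  apply: (@probability_bounded_integrable _ _ _ nu _ K); first exact: measurable_funM.
  by move=> y; rewrite normrM (ger0_norm (s0 y)) (le_trans _ (aK y))// ler_piMl.
by apply: eq_integral => y _; rewrite -EFinB -EFinM /a1; congr _%:E; ring.
Qed.

(* 0 <= E[f 1_U] = P(U) E[f] and E[f] < 0, under P_nu *)
Let r_eq0 : r = 0%R.
Proof.
pose X : {mfun Omega >-> path_space T} :=
  HB.pack_for {mfun Omega >-> path_space T} (traj 0)
    (isMeasurableFun.Build _ _ _ _ (traj 0) (mtraj 0)).
have pres A : measurable A ->
    distribution (Pr nu) X (@shift d T @^-1` A) = distribution (Pr nu) X A.
  by move=> mA; rewrite -[RHS]/(Pr nu (traj 0 @^-1` A)) -stationary_path.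
have := integral_unbounded_sums (@measurable_shift d T) mf fC pres.
rewrite -/U -integral_mul_indic.
have mfU : measurable_fun setT (fun p => (f p * \1_U p)%R).
  exact: measurable_funM.
have fUC p : (`|f p * \1_U p| <= K + `|c|)%R.
  rewrite normrM (le_trans _ (fC p))// ler_piMr//.
  by rewrite indicE; case: (_ \in _); rewrite ?normr1 ?normr0.
have imU : measurable_fun setT (EFin \o (fun p => (f p * \1_U p)%R)).
  exact/measurable_EFinP.
rewrite (_ : \int[_]_w _ =
    \int[distribution (Pr nu) X]_p (EFin \o (fun p => (f p * \1_U p)%R)) p)//.
rewrite integral_distribution//; last first.
  apply: (@probability_bounded_integrable _ _ _ _ _ (K + `|c|)).
    exact: (measurableT_comp mfU (mtraj 0)).
  by move=> w; exact: fUC.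
have s_int : nu.-integrable setT (EFin \o (fun y => (s y * a y)%R)).
  apply: (@probability_bounded_integrable _ _ _ nu _ K); first exact: measurable_funM.
  by move=> y; rewrite normrM (ger0_norm (s0 y)) (le_trans _ (aK y))// ler_piMl.
have -> : \int[Pr nu]_w ((EFin \o (fun p => (f p * \1_U p)%R)) \o X) w =
    r%:E * \int[nu]_y (s y * a y)%:E + r%:E * c%:E.
  rewrite -head_integral.
  have -> : r%:E * c%:E = \int[Pr nu]_w (c * \1_U' w)%:E.
    under eq_integral do rewrite EFinM.
    rewrite integral_mul_indic integral_cst//. 
    by rewrite muleC; congr (_ * _); rewrite -rE.
  rewrite -integralD_EFin//; last 2 first.
  - apply: (@probability_bounded_integrable _ _ _ _ _ K).
      by apply: measurable_funM => //; exact: measurableT_comp.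
    move=> w; rewrite normrM (le_trans _ (aK (Z 0%N w)))// ler_piMl//.
    by rewrite indicE; case: (_ \in _); rewrite ?normr1 ?normr0.
  - apply: (@probability_bounded_integrable _ _ _ _ _ `|c|).
      exact: measurable_funM.
    move=> w; rewrite normrM ler_piMr//.
    by rewrite indicE; case: (_ \in _); rewrite ?normr1 ?normr0.
  apply: eq_integral => w _ /=; rewrite -EFinD; congr _%:E.
  rewrite -[\1_U (traj 0 w)]/(\1_U' w) /D indicI/= /f /traj /trajectory/= !indicE.
  ring.
have [v vE] : exists v, \int[nu]_y (s y * a y)%:E = v%:E.
  exists (fine (\int[nu]_y (s y * a y)%:E)); rewrite fineK//.
  exact: integrable_fin_num s_int.
rewrite vE; move: mean_neg; rewrite vE -EFinD lte_fin => vc.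
rewrite -!EFinM -EFinD lee_fin -mulrDr => rvc.
apply/eqP; rewrite eq_le r0 andbT leNgt; apply/negP => rp.
by have := pmulr_rlt0 (v + c) rp; rewrite vc ltNge rvc.
Qed.

(** The almost sure statement from which all limits are drawn: partial sums of
    a function of negative mean stay bounded above, from every starting point. *)
Lemma ae_bounded_sums x : {ae Pr (dirac x), forall w, exists N : nat, forall n,
  (\sum_(i < n) (a (Z i w) * \1_(J i) w + c) <= N%:R)%R}.
Proof.
exists U'; split => //.
  have := path_kernel_invariant mU shiftU x; rewrite -/U' rE r_eq0; exact.
move=> w /= nw; apply: contrapT => nU; apply: nw.
have /existsNP[N nUN] : ~ forall N : nat, exists n,
    (N%:R < \sum_(i < n) f (iter i (@shift d T) (traj 0 w)))%R by [].
exists N => n; rewrite leNgt; apply/negP => Nn; apply: nUN; exists n.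
rewrite (lt_le_trans Nn)//; apply: ler_sum => i _.
by rewrite /f iter_shift /traj /trajectory/= indicE.
Qed.

End bounded_sums.
End ergodic.

(** * Jump rates, survival functions and their mixtures *)

(** X n and Y n play the roles of the sums in the numerator and in the denominator;
    bounds of this form are what ae_bounded_sums provides. *)
Lemma ratio_cvg (R : realType) (X Y : nat -> R) (l eta : R) :
  0 < eta ->
  (exists N, forall n, n%:R * eta - Y n <= N) ->
  (forall k : nat, exists N, forall n, X n - (l + k.+1%:R^-1) * Y n <= N) ->
  (forall k : nat, exists N, forall n, (l - k.+1%:R^-1) * Y n - X n <= N) ->
  (if Y n == 0 then 0 else 1 / Y n) * X n @[n --> \oo] --> l.
Proof.
move=> eta0 [N3 YN] XN1 XN2.
apply/cvgrPdist_lt => e e0.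
have [k ke] : exists k : nat, k.+1%:R^-1 < e / 2.
  exists (Num.bound (e / 2)^-1); rewrite invf_plt ?posrE ?divr_gt0//.
  rewrite (lt_trans (archi_boundP _))//; first by rewrite invr_ge0 divr_ge0// ltW.
  by rewrite ltr_nat.
have [N1 XN1k] := XN1 k; have [N2 XN2k] := XN2 k.
pose N := `|N1| + `|N2|.
have N0 : 0 <= N by rewrite addr_ge0.
pose b := (2 * N / e + 1 + N3) / eta.
near=> n.
have nb : b < n%:R.
  near: n; exists (Num.bound `|b|).+1 => //= n.
  move=> bn; rewrite (le_lt_trans (ler_norm _))// (lt_trans (archi_boundP _))//.
  by rewrite ltr_nat.
have Yn : 2 * N / e + 1 < Y n.
  have := YN n; move: nb; rewrite /b ltr_pdivrMr//; lra.
have Ne : 0 <= 2 * N / e by rewrite divr_ge0 ?mulr_ge0// ltW.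
have Y0 : 0 < Y n by lra.
have NY : 2 * N < e * Y n.
  have : 2 * N / e < Y n by lra.
  by rewrite ltr_pdivrMr// (mulrC e).
rewrite gt_eqF// mul1r distrC.
have -> : (Y n)^-1 * X n - l = (X n - l * Y n) / Y n.
  by rewrite mulrBl mulfK ?gt_eqF// mulrC.
rewrite normrM normfV (gtr0_norm Y0) ltr_pdivrMr// ltr_norml.
have kY : k.+1%:R^-1 * Y n < e / 2 * Y n by rewrite ltr_pM2r.
have N1N : N1 <= N by rewrite (le_trans (ler_norm _))// lerDl.
have N2N : N2 <= N by rewrite (le_trans (ler_norm _))// lerDr.
have eY : e / 2 * Y n = e * Y n / 2 by rewrite mulrAC.
have := XN1k n; have := XN2k n; rewrite eY in kY; move: kY.
rewrite mulrBl mulrDl; move: (_^-1 * Y n) (l * Y n) (e * Y n) NY => q lY eY'.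
move: (X n) => x h3 h4 h5 h6.
by apply/andP; split; lra.
Unshelve. all: by end_near. Qed.

Lemma continuous_comp_within (R : realType) (A : set R) (f g : R -> R) :
  {within A, continuous f} -> continuous g -> (forall x, A (g x)) ->
  continuous (f \o g).
Proof.
move=> /subspace_continuousP cf cg Ag x V /= fgxV.
have := cf (g x) (Ag x) V fgxV; rewrite nbhs_simpl /within/= => gxV.
have := cg x _ gxV; rewrite !nbhs_simpl/=.
by apply: filterS => y; exact.
Qed.

Section state_functions.
Context (R : realType) (X : metricType R) (E : set X) (e0 : E).
Local Notation EE := (state e0).

Lemma measurable_state_open (U : set EE) : open U -> measurable U.
Proof. by move=> oU; exact: sub_sigma_algebra. Qed.

Lemma measurable_state_continuous (f : EE -> R) :
  continuous f -> measurable_fun setT f.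
Proof.
move=> /continuousP cf; apply: (measurability _ (RGenOpens.measurableE R)) => //.
move=> _ [_ [a [b ->]] <-]; rewrite setTI.
by apply: measurable_state_open; apply: cf; exact: interval_open.
Qed.

Lemma lipschitz_state_continuous (f : EE -> R) (L : R) : 0 <= L ->
  (forall x y, `|f x - f y| <= L * mdist (val x) (val y)) -> continuous f.
Proof.
move=> L0 fL x.
have FF : ProperFilter (nbhs x) by exact: (@nbhs_pfilter EE).
apply/(@cvgrPdist_lt _ _ _ (nbhs x) FF) => e e0'.
have d0 : 0 < e / (L + 1) by rewrite divr_gt0// ltr_wpDl.
apply/(@nbhs_ballP R EE); exists (e / (L + 1)) => //= y.
rewrite -[ball x _ y]/(ball (val x) (e / (L + 1)) (val y)) ballEmdist/= => xy.
rewrite (le_lt_trans (fL x y))//.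
rewrite (@le_lt_trans _ _ ((L + 1) * mdist (val x) (val y)))//.
  by rewrite ler_wpM2r ?mdist_ge0// lerDl.
by rewrite -ltr_pdivlMl ?ltr_wpDl// mulrC.
Qed.

End state_functions.

Section rate_functions.
Context (R : realType) (X : metricType R) (E : set X) (e0 : E).
Local Notation EE := (state e0).
Context (lam : EE -> R -> R) (M : R -> R) (L : R).
Hypothesis lam_ge0 : forall xi (s : R), 0 <= s -> 0 <= lam xi s.
Hypothesis lam_meas : forall xi, measurable_fun (`[0, +oo[ : set R) (lam xi).
Hypothesis L0 : 0 < L.
Hypothesis lam_lip : forall (xi xi' : EE) (s : R), 0 <= s ->
  `|lam xi s - lam xi' s| <= L * mdist (val xi) (val xi').
Hypothesis M_int : forall T : R, 0 <= T ->
  lebesgue_measure.-integrable `[0, T] (EFin \o M).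
Hypothesis lam_le : forall xi (s : R), 0 <= s -> lam xi s <= M s.

Local Notation mu := (@lebesgue_measure R).

Let lam_int xi (T : R) : 0 <= T -> mu.-integrable `[0, T] (EFin \o lam xi).
Proof.
move=> T0; apply: (le_integrable _ _ _ (M_int T0)) => //.
- apply/measurable_EFinP; apply: measurable_funS (lam_meas xi) => //.
  by apply: subset_itvl; rewrite bnd_simp.
- move=> s /=; rewrite in_itv/= => /andP[s0 _]; rewrite lee_fin.
  by rewrite ger0_norm ?lam_ge0// (le_trans (lam_le _ _))// ler_norm.
Qed.

Let cumul xi t := \int[mu]_(s in `[0, t]) lam xi s.

Lemma continuous_rate (s : R) : 0 <= s -> continuous (lam ^~ s).
Proof.
move=> s0; apply: (@lipschitz_state_continuous _ _ _ _ _ L); first exact: ltW.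
by move=> x y; exact: lam_lip.
Qed.

Let cumul_continuous (t : R) : 0 <= t -> continuous (cumul ^~ t).
Proof.
move=> t0; apply: (@lipschitz_state_continuous _ _ _ _ _ (L * t)).
  by rewrite mulr_ge0// ltW.
move=> x y; rewrite /cumul -RintegralB//; [|exact: lam_int..].
have mt : (mu `[0%R, t] < +oo)%E by rewrite lebesgue_measure_itv/=; case: ifP => _; rewrite ltry.
have Iint : mu.-integrable `[0, t] (EFin \o (fun s => lam x s - lam y s)).
  exact: (@integrableB _ _ _ mu _ _ (EFin \o lam x) (EFin \o lam y) (lam_int x t0) (lam_int y t0)).
rewrite (le_trans (le_normr_Rintegral _ Iint))//.
have -> : L * t * mdist (val x) (val y) =
    \int[mu]_(s in `[0, t]) (cst (L * mdist (val x) (val y)) s).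
  rewrite Rintegral_cst//= lebesgue_measure_itv/= lte_fin.
  rewrite mulrAC; congr (_ * _); case: ltP => // t0'; first by rewrite sube0.
  by apply/eqP; rewrite eq_le t0 t0'.
apply: le_Rintegral => //.
- exact: (@integrable_norm _ _ _ mu _ (fun s => lam x s - lam y s)).
- apply: measurable_bounded_integrable => //.
  exists `|L * mdist (val x) (val y)|; split; first exact: num_real.
  by move=> K Kx s _ /=; exact: ltW.
- by move=> s; rewrite /= in_itv/= => /andP[s0 _]; exact: lam_lip.
Qed.

Lemma continuous_Glam (t : R) : 0 <= t -> continuous ((Glam lam)^~ t).
Proof.
move=> t0 x; rewrite /Glam.
apply: (@continuous_comp _ _ _ (fun xi => - cumul xi t) expR); last exact: continuous_expR.
by apply: continuousN; exact: cumul_continuous.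
Qed.

Lemma continuous_flam (t : R) : 0 <= t -> continuous ((flam lam)^~ t).
Proof.
by move=> t0 x; exact: cvgM (continuous_rate t0 (x := x)) (continuous_Glam t0 (x := x)).
Qed.

Lemma Glam_gt0 xi t : 0 < Glam lam xi t.
Proof. exact: expR_gt0. Qed.

Lemma Glam_le1 xi t : Glam lam xi t <= 1.
Proof.
rewrite /Glam -expR0 ler_expR oppr_le0.
by apply: Rintegral_ge0 => s; rewrite /= in_itv/= => /andP[s0 _]; exact: lam_ge0.
Qed.

(** The bound is uniform in the state, hence survives integration over A. *)
Lemma Glam_ge (t : R) : 0 <= t ->
  forall xi, expR (- \int[mu]_(s in `[0, t]) M s) <= Glam lam xi t.
Proof.
move=> t0 xi; rewrite /Glam ler_expR lerN2; apply: le_Rintegral => //.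
- exact: lam_int.
- exact: M_int.
- by move=> s; rewrite /= in_itv/= => /andP[s0 _]; exact: lam_le.
Qed.

Lemma continuous_Glam_time xi : {within `[0, +oo[, continuous (Glam lam xi)}.
Proof.
apply/subspace_continuousP => s; rewrite /= in_itv/= andbT => s0.
have s10 : 0 <= s + 1 by rewrite addr_ge0.
have := parameterized_integral_continuous s10 (lam_int xi s10).
move=> /subspace_continuousP/(_ s); rewrite /= in_itv/= s0 lerDl ler01 => /(_ isT) cs.
apply: (@cvg_comp _ _ _ (fun t => - cumul xi t) expR); last exact: continuous_expR.
apply: cvgN => V /cs; rewrite !nbhs_simpl /within/= => cV.
near=> u => u0; apply: (near cV u) => //.
move: u0; rewrite !in_itv/= andbT => ->/=; rewrite ltW//.
by near: u; apply: lt_nbhsl; rewrite ltrDl.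
Unshelve. all: by end_near. Qed.

Section mixture.
Context (nu : probability EE R) (A : set EE) (C : R).
Hypothesis mA : measurable A.
Hypothesis nuA : (0 < nu A)%E.
Hypothesis f_cont : forall xi, {within `[0, +oo[, continuous (flam lam xi)}.
Hypothesis f_bnd : forall xi (t : R), 0 <= t -> `|flam lam xi t| <= C.

Let max0_ge0 (s : R) : 0 <= Num.max s 0. Proof. by rewrite le_max lexx orbT. Qed.

Let max0_cont : continuous (fun s : R => Num.max s 0).
Proof. by move=> s; apply: (@continuous_max _ _ idfun (cst 0)); [exact: cvg_id|exact: cvg_cst]. Qed.

Lemma bounded_integrable_on (h : EE -> R) (K : R) : measurable_fun setT h ->
  (forall z, `|h z| <= K) -> nu.-integrable A (EFin \o h).
Proof.
move=> mh hK; apply: (@integrableS _ _ _ nu setT) => //.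
exact: probability_bounded_integrable hK.
Qed.

(** Clamping time at 0 turns continuity on the closed half-line into continuity on
    the whole line, so that continuity under the integral sign applies on an
    open interval around each time. *)
Lemma continuous_integral_time (h : EE -> R -> R) (K : R) :
  (forall s : R, 0 <= s -> measurable_fun setT (h ^~ s)) ->
  (forall z (s : R), 0 <= s -> `|h z s| <= K) ->
  (forall z, {within `[0, +oo[, continuous (h z)}) ->
  continuous (fun s : R => \int[nu]_(z in A) h z (Num.max s 0)).
Proof.
move=> mh hK ch s.
suff : {in (`]s - 1, s + 1[%classic : set R),
    continuous (fun s : R => \int[nu]_(z in A) h z (Num.max s 0))}.
  by apply; rewrite inE/= in_itv/= ltrBlDr !ltrDl ltr01.
apply: (@continuity_under_integral R _ EE nu (fun s z => h z (Num.max s 0)) A mA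
  (s - 1) (s + 1) _ _ (cst K)).
- by move=> x _; apply: (@bounded_integrable_on _ K) => [|z]; [exact: mh|exact: hK].
- apply: aeW => z _ x _.
  have itv0 y : (`[0, +oo[%classic : set R) (Num.max y 0).
    by rewrite /= in_itv/= andbT.
  exact: (continuous_comp_within (ch z) max0_cont itv0).
- exact: (@bounded_integrable_on (cst K) `|K|).
- by move=> x _; apply: aeW => z _; exact: hK.
Qed.

Lemma measurable_Glam (t : R) : 0 <= t -> measurable_fun setT ((Glam lam)^~ t).
Proof. by move=> t0; apply: measurable_state_continuous; exact: continuous_Glam. Qed.

Lemma measurable_flam (t : R) : 0 <= t -> measurable_fun setT ((flam lam)^~ t).
Proof. by move=> t0; apply: measurable_state_continuous; exact: continuous_flam. Qed.

Let Glam_bnd z s : `|Glam lam z s| <= 1.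
Proof. by rewrite gtr0_norm ?Glam_gt0// Glam_le1. Qed.

Lemma integral_Glam_gt0 (t : R) : 0 <= t -> 0 < \int[nu]_(z in A) Glam lam z t.
Proof.
move=> t0; pose c := expR (- \int[mu]_(s in `[0, t]) M s).
have : \int[nu]_(z in A) cst c z <= \int[nu]_(z in A) Glam lam z t.
  apply: le_Rintegral => //.
  - exact: (@bounded_integrable_on (cst c) `|c|).
  - by apply: (@bounded_integrable_on _ 1); [exact: measurable_Glam|move=> z].
  - by move=> z _; exact: Glam_ge.
apply: lt_le_trans; rewrite Rintegral_cst// mulr_gt0 ?expR_gt0// fine_gt0// nuA.
by rewrite (le_lt_trans (probability_le1 _ mA))// ltry.
Qed.

Lemma continuous_llam : {within `[0, +oo[, continuous (llam lam nu A)}.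
Proof.
pose N (s : R) := \int[nu]_(z in A) flam lam z (Num.max s 0).
pose D (s : R) := \int[nu]_(z in A) Glam lam z (Num.max s 0).
have cN : continuous N.
  exact: (continuous_integral_time measurable_flam f_bnd).
have cD : continuous D.
  apply: (@continuous_integral_time _ 1 measurable_Glam) => //.
  exact: continuous_Glam_time.
have D0 s : D s != 0 by rewrite gt_eqF// integral_Glam_gt0.
apply: (@subspace_eq_continuous _ _ _ (fun s => N s / D s)).
  move=> s; rewrite inE/= in_itv/= andbT => s0.
  by rewrite /N /D /llam max_l.
apply: continuous_subspaceT => s.
by apply: cvgM; [exact: cN|apply: cvgV; [exact: D0|exact: cD]].
Qed.

Lemma Klam_lty (t : R) : 0 <= t -> (Klam lam nu t A < +oo)%E.
Proof.
move=> t0.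
have c : {within `[0, t], continuous (fun s => `|llam lam nu A s|)}.
  have c0 : {within `[0, t], continuous (llam lam nu A)}.
    apply: continuous_subspaceW continuous_llam.
    by apply: subset_itvl; rewrite bnd_simp.
  by move=> s; apply: cvg_norm; exact: c0.
have [m _ mt] := EVT_max t0 c.
apply: (@le_lt_trans _ _ (`|llam lam nu A m|)%:E); last exact: ltry.
by apply: ge_ereal_sup => _ [s /= st <-]; rewrite lee_fin mt.
Qed.

End mixture.
End rate_functions.

(** * The censored jump process *)

Section process_facts.
Context (R : realType) (X : metricType R) (E : set X) (e0 : E).
Local Notation EE := (state e0).
Context (dO dU dV : measure_display) (Omega : measurableType dO)
  (U : measurableType dU) (V : measurableType dV).
Context (Q : R.-pker EE ~> EE) (lam : EE -> R -> R) (tstar : EE -> \bar R).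
Context (psi : EE * U -> EE) (phi : EE * V -> \bar R).
Context (Z : nat -> {mfun Omega >-> EE}) (S : nat -> {mfun Omega >-> \bar R}).
Context (eps : nat -> {mfun Omega >-> U}) (delta : nat -> {mfun Omega >-> V}).
Context (nu0 : probability EE R) (P : probability Omega R).
Hypothesis process : marked_renewal_process Q lam tstar psi phi Z S eps delta nu0 P.

Definition late (t : R) (n : nat) : set Omega := [set w | (t%:E < S n.+1 w)%E].

Let lateE t n : late t n = S n.+1 @^-1` `]t%:E, +oo[%classic.
Proof. by apply/seteqP; split => w; rewrite /late /= in_itv/= andbT. Qed.

Let late_measurable t n : measurable (late t n).
Proof. by rewrite lateE; apply: measurable_funPTI; exact: emeasurable_itv. Qed.

Lemma marked_chain_process (t : R) : 0 <= t ->
  (forall xi s, 0 <= s -> 0 <= lam xi s) ->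
  measurable_fun setT ((survival lam tstar)^~ t) ->
  marked_chain Q ((survival lam tstar)^~ t) Z (late t) P.
Proof.
move=> t0 lam_ge0 ms; split => //.
- by move=> y; rewrite mulr_ge0// ltW// Glam_gt0.
- move=> y; rewrite /survival; case: (_ < _)%E; rewrite ?mulr1 ?mulr0//.
  exact: Glam_le1.
- by move=> n B mB H FH; have [_] := mrp_markov process n mB; exact.
- move=> n H FH; have [_ /(_ H)] := mrp_law process n t0; apply.
  move: H FH; apply: smallest_sub; first exact: smallest_sigma_algebra.
  move=> H [ZH|[k kn <-]]; apply: sub_sigma_algebra; [by left|right].
  apply: sub_sigma_algebra; exists k.+1 => //.
  exists `]t%:E, +oo[%classic; first exact: emeasurable_itv.
  by rewrite setTI lateE.
Qed.


Context (M : R -> R) (L : R).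
Hypothesis lam_ge0 : forall xi (s : R), 0 <= s -> 0 <= lam xi s.
Hypothesis lam_meas : forall xi, measurable_fun (`[0, +oo[ : set R) (lam xi).
Hypothesis L0 : 0 < L.
Hypothesis lam_lip : forall (xi xi' : EE) (s : R), 0 <= s ->
  `|lam xi s - lam xi' s| <= L * mdist (val xi) (val xi').
Hypothesis M_int : forall T : R, 0 <= T ->
  lebesgue_measure.-integrable `[0, T] (EFin \o M).
Hypothesis lam_le : forall xi (s : R), 0 <= s -> lam xi s <= M s.
Hypothesis tstar_gt0 : forall xi, (0 < tstar xi)%E.
Context (A : set EE) (t : R).
Hypothesis mA : measurable A.
Hypothesis t0 : 0 <= t.
Hypothesis tA : (t%:E < tstar_inf tstar A)%E.

Let Z_law n := distribution P (Z n).
Let mean_G n (s : R) := \int[Z_law n]_(z in A) Glam lam z (Num.max s 0).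

Let survival_A z (s : R) : A z -> s <= t -> survival lam tstar z s = Glam lam z s.
Proof.
move=> Az st; rewrite /survival (_ : (s%:E < tstar z)%E = true) ?mulr1//.
rewrite (@le_lt_trans _ _ t%:E) ?lee_fin// (lt_le_trans tA)//.
by apply: ereal_inf_lbound; exists z.
Qed.

Let prob_late n (s : R) : 0 <= s -> s <= t ->
  P (late s n `&` (Z n @^-1` A)) = (mean_G n s)%:E.
Proof.
move=> s0 st; have [_ ->] := mrp_law_Z process n s0; last first.
  by exists A => //; rewrite setTI.
have iG : (Z_law n).-integrable A (EFin \o (Glam lam)^~ s).
  apply: (@bounded_integrable_on _ _ _ _ _ _ mA _ 1).
    exact: (measurable_Glam lam_ge0 lam_meas L0 lam_lip M_int lam_le).
  by move=> z; rewrite gtr0_norm ?Glam_gt0// Glam_le1.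
rewrite /mean_G max_l// /Rintegral fineK; last exact: integrable_fin_num iG.
rewrite ge0_integral_pushforward//.
- by apply: eq_integral => w; rewrite inE => /= Aw; rewrite survival_A.
- by case/integrableP : iG.
- by move=> z _; rewrite lee_fin ltW// Glam_gt0.
Qed.

(** P(S_(n+1) = t, Z_n in A) is at most the decrease between s < t and t of the mean
    of G(., s) over A, and this mean is continuous in s. At t = 0 it vanishes
    because S_(n+1) > 0 almost surely. *)
Lemma ae_late : {ae P, forall w, forall n,
  ((t%:E <= S n.+1 w)%E)%:R * \1_A (Z n w) = \1_(late t n) w * \1_A (Z n w) :> R}.
Proof.
apply: ae_foralln => n.
pose D := [set w | (t%:E <= S n.+1 w)%E] `&` (Z n @^-1` A) `\` late t n.
have mle s : measurable [set w | (s <= S n.+1 w)%E].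
  rewrite (_ : [set w | _] = S n.+1 @^-1` `[s, +oo[%classic).
    by apply: measurable_funPTI; exact: emeasurable_itv.
  by apply/seteqP; split => w; rewrite /= in_itv/= andbT.
have mZA : measurable (Z n @^-1` A) by exact: measurable_funPTI.
have mD : measurable D by apply: measurableD => //; exact: measurableI.
suff D0 : P D = 0%E.
  exists D; split => // w /= nw; apply: contrapT => nD; apply: nw.
  rewrite !indicE; have [ZA|ZA] := pselect (A (Z n w)); last first.
    by rewrite (memNset ZA) !mulr0.
  rewrite (mem_set ZA) !mulr1; congr (_%:R); congr nat_of_bool.
  apply/idP/idP => [tS|]; last by rewrite inE => /ltW.
  by rewrite inE; apply: contrapT => h; exact: nD.
have [t_eq0|t_neq0] := eqVneq t 0.
  have : P (late 0 n) = 1%E.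
    have [_ /(_ setT)] := mrp_law_Z process n (lexx 0).
    rewrite setIT => ->; last by exists setT => //; rewrite setTI preimage_setT.
    rewrite (eq_integral (cst 1%E)).
      by rewrite integral_cst// mul1e; exact: probability_setT.
    move=> w _; rewrite /survival tstar_gt0 mulr1 /Glam.
    by rewrite set_itv1 Rintegral_set1 oppr0 expR0.
  move=> P1; apply/eqP; rewrite -measure_le0.
  have <- : P (~` late 0 n) = 0%E by rewrite probability_setC// P1 subee.
  apply: le_measure; rewrite ?inE//; first exact: measurableC.
  by rewrite /D t_eq0 => w [].
have tp : 0 < t by rewrite lt_neqAle eq_sym t_neq0.
have D_le s : 0 <= s -> s < t -> (P D <= (mean_G n s - mean_G n t)%:E)%E.
  move=> s0 st.
  have sub : late t n `<=` late s n.
    by move=> w; rewrite /late/=; apply: lt_trans; rewrite lte_fin.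
  have mX u : measurable (late u n `&` (Z n @^-1` A)) by exact: measurableI.
  suff : (P D <= P (late s n `&` (Z n @^-1` A)) - P (late t n `&` (Z n @^-1` A)))%E.
    move/le_trans; apply.
    by rewrite (prob_late n s0 (ltW st)) (prob_late n t0 (lexx t)).
  have <- : late s n `&` (Z n @^-1` A) `&` (late t n `&` (Z n @^-1` A)) =
      late t n `&` (Z n @^-1` A).
    by apply/setIidr; apply: setSI.
  rewrite -measureD//; last exact: le_lt_trans (probability_le1 _ (mX s)) (ltry _).
  apply: le_measure; rewrite ?inE//; first exact: measurableD.
  move=> w [[tS Aw] nS]; split; last by case.
  by split => //; apply: lt_le_trans tS; rewrite lte_fin.
have cG : continuous (mean_G n).
  apply: (@continuous_integral_time _ _ _ _ _ _ mA _ 1).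
  - by move=> s s0; exact: (measurable_Glam lam_ge0 lam_meas L0 lam_lip M_int lam_le).
  - by move=> z s _; rewrite gtr0_norm ?Glam_gt0// Glam_le1.
  - by move=> z; exact: (continuous_Glam_time lam_ge0 lam_meas M_int lam_le).
apply/eqP; rewrite -measure_le0; apply/lee_addgt0Pr => e e0'; rewrite add0e.
have /cvgrPdist_lt/(_ _ e0')/nbhs_ballP[r /= r0 rG] := cG t.
pose s := Num.max 0 (t - r / 2).
have s0 : 0 <= s by rewrite /s le_max lexx.
have st : s < t by rewrite /s gt_max tp/= ltrBlDr ltrDl divr_gt0.
apply: le_trans (D_le _ s0 st) _; rewrite lee_fin.
have /rG : ball t r s.
  rewrite /ball/= gtr0_norm ?subr_gt0//.
  have : t - r / 2 <= s by rewrite /s le_max lexx orbT.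
  by lra.
by rewrite ltr_norml => /andP[+ _]; rewrite ltrNl opprB => /ltW.
Qed.

End process_facts.

Theorem proposition4p12
  (R : realType) (X : metricType R) (X_separable : separable_space X)
  (E : set X) (E_open : open E) (e0 : E)
  (Q : R.-pker (state e0) ~> (state e0))
  (lam : state e0 -> R -> R)
  (lam_ge0 : forall (xi : state e0) (s : R), 0 <= s -> 0 <= lam xi s)
  (lam_measurable : forall xi : state e0, measurable_fun (`[0, +oo[ : set R) (lam xi))
  (tstar : state e0 -> \bar R) (tstar_gt0 : forall xi : state e0, (0 < tstar xi)%E)
  (dO dU dV : measure_display) (Omega : measurableType dO)
  (U : measurableType dU) (V : measurableType dV)
  (psi : state e0 * U -> state e0) (psi_measurable : measurable_fun setT psi)
  (phi : state e0 * V -> \bar R) (phi_measurable : measurable_fun setT phi)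
  (Z : nat -> {mfun Omega >-> state e0}) (S : nat -> {mfun Omega >-> \bar R})
  (eps : nat -> {mfun Omega >-> U}) (delta : nat -> {mfun Omega >-> V})
  (Pr : probability (state e0) R -> probability Omega R)
  (process : forall nu0 : probability (state e0) R,
     marked_renewal_process Q lam tstar psi phi Z S eps delta nu0 (Pr nu0))
  (nu : probability (state e0) R)
  (standing : standing_assumptions Q lam tstar Z Pr nu)
  (A : set (state e0)) (A_Bplus : Bplus nu A)
  (t : R) (t_ge0 : 0 <= t) (t_lt : (t%:E < tstar_inf tstar A)%E)
  (x : state e0) :
  [/\ {ae Pr (dirac x), forall w : Omega,
         Yplus Z S A t n w *
           (\sum_(i < n) lam (Z i w) t * \1_A (Z i w) *
              ((t%:E <= S i.+1 w)%E)%:R)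
         @[n --> \oo] --> llam lam nu A t},
      {within [set s : R | 0 <= s /\ (s%:E < tstar_inf tstar A)%E],
         continuous (llam lam nu A)} &
      (Klam lam nu t A < +oo)%E].
Proof.
have [L L0 lam_lip] := sa_lipschitz standing.
have [M [_ M_int lam_le]] := sa_dominated standing.
have [C f_bnd] := sa_f_bounded standing.
have f_cont := sa_f_continuous standing.
have [mA _ nuA _] := A_Bplus.
have cont_l := continuous_llam lam_ge0 lam_measurable L0 lam_lip M_int lam_le
  mA nuA f_cont f_bnd.
split; last exact: (Klam_lty lam_ge0 lam_measurable L0 lam_lip M_int lam_le
  mA nuA f_cont f_bnd).
- pose J := late S t.
  pose surv := (survival lam tstar)^~ t.
  have mG := measurable_Glam lam_ge0 lam_measurable L0 lam_lip M_int lam_le t_ge0.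
  have mf := measurable_flam lam_ge0 lam_measurable L0 lam_lip M_int lam_le t_ge0.
  have mlam : measurable_fun setT (lam ^~ t).
    apply: measurable_state_continuous; exact: (continuous_rate L0 lam_lip t_ge0).
  have msurv : measurable_fun setT surv.
    apply: measurable_funM => //.
    rewrite (_ : (fun _ => _) = \1_[set z | (t%:E < tstar z)%E]).
      apply: measurable_indic; apply: measurable_state_open.
      have := sa_tstar_continuous standing => /continuousP.
      move=> /(_ [set u | (t%:E < u)%E]); apply; exact: open_ereal_gt_ereal.
    by apply/funext => z; rewrite indicE mem_setE.
  have PrP mu := marked_chain_process (process mu) t_ge0 lam_ge0 msurv.
  have Pr_init (mu : probability (state e0) R) B :
      measurable B -> Pr mu (Z 0%N @^-1` B) = mu B.
    exact: (mrp_init (process mu)).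
  have Pr_cvg (y : state e0) B : measurable B ->
      Pr (dirac y) (Z n @^-1` B) @[n --> \oo] --> nu B.
    move=> mB; exact: (tv_cvg_setwise (sa_ergodic standing y) mB).
  pose IF := \int[nu]_(z in A) flam lam z t.
  pose IG := \int[nu]_(z in A) Glam lam z t.
  have IG0 : 0 < IG.
    exact: (integral_Glam_gt0 lam_ge0 lam_measurable L0 lam_lip M_int lam_le
      mA nuA t_ge0).
  have surv_A z : A z -> surv z = Glam lam z t.
    move=> Az; rewrite /surv /survival (_ : (t%:E < tstar z)%E = true) ?mulr1//.
    by rewrite (lt_le_trans t_lt)//; apply: ereal_inf_lbound; exists z.
  have iF : nu.-integrable A (EFin \o (flam lam)^~ t).
    by apply: (bounded_integrable_on nu mA mf (K := C)) => z; exact: f_bnd.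
  have iG : nu.-integrable A (EFin \o (Glam lam)^~ t).
    apply: (bounded_integrable_on nu mA mG (K := 1)) => z.
    by rewrite gtr0_norm ?Glam_gt0// Glam_le1.
  (* the mean of (alpha lambda + beta) 1_A 1_J + c under nu is
     alpha IF + beta IG + c *)
  have sums alpha beta c : alpha * IF + beta * IG + c < 0 ->
      {ae Pr (dirac x), forall w, exists N : nat, forall n,
        \sum_(i < n) ((alpha * lam (Z i w) t + beta) * \1_A (Z i w) * \1_(J i) w + c)
          <= N%:R}.
    move=> mean.
    apply: (ae_bounded_sums PrP Pr_init Pr_cvg
      (a := fun z => (alpha * lam z t + beta) * \1_A z) (K := `|alpha| * M t + `|beta|)).
    + apply: measurable_funM; last exact: measurable_indic.
      by apply: measurable_funD => //; exact: measurable_funM.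
    + move=> z; rewrite normrM (@le_trans _ _ `|alpha * lam z t + beta|)//.
        by rewrite ler_piMr// indicE; case: (_ \in _); rewrite ?normr1 ?normr0.
      rewrite (le_trans (ler_normD _ _))// lerD2r normrM ler_wpM2l//.
      by rewrite ger0_norm ?lam_ge0 ?lam_le.
    + have -> : (\int[nu]_y (surv y * ((alpha * lam y t + beta) * \1_A y))%:E =
          (alpha * IF + beta * IG)%:E)%E.
        have iaF := integrableZl mA alpha iF.
        have ibG := integrableZl mA beta iG.
        rewrite /IF /IG -RintegralZl// -RintegralZl// -RintegralD//.
        rewrite /Rintegral fineK; last first.
          exact: integrable_fin_num (integrableD mA iaF ibG).
        rewrite -integral_mul_indic; apply: eq_integral => z _.
        rewrite -EFinM indicE; have [Az|nAz] := pselect (A z); last first.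
          by rewrite memNset// !mulr0.
        rewrite surv_A// /flam; congr _%:E; ring.
      by rewrite -EFinD lte_fin.
  have ell : llam lam nu A t = IF / IG by [].
  (* eta = IG / 2 and eps = 1 / (k + 1) *)
  have all_sums : {ae Pr (dirac x), forall w,
      [/\ exists N : nat, forall n, \sum_(i < n)
            ((0 * lam (Z i w) t + -1) * \1_A (Z i w) * \1_(J i) w + IG / 2) <= N%:R,
          forall k : nat, exists N : nat, forall n, \sum_(i < n)
            ((1 * lam (Z i w) t + - (IF / IG + k.+1%:R^-1)) * \1_A (Z i w) * \1_(J i) w + 0)
            <= N%:R &
          forall k : nat, exists N : nat, forall n, \sum_(i < n)
            ((-1 * lam (Z i w) t + (IF / IG - k.+1%:R^-1)) * \1_A (Z i w) * \1_(J i) w + 0)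
            <= N%:R]}.
    have IGV : IF / IG * IG = IF by rewrite divfK// gt_eqF.
    have kIG (k : nat) : 0 < k.+1%:R^-1 * IG by rewrite mulr_gt0// invr_gt0.
    have s1 : 0 * IF + -1 * IG + IG / 2 < 0 by lra.
    have s2 (k : nat) : 1 * IF + - (IF / IG + k.+1%:R^-1) * IG + 0 < 0.
      by rewrite mulNr mulrDl IGV mul1r addr0 opprD addrA subrr add0r oppr_lt0.
    have s3 (k : nat) : -1 * IF + (IF / IG - k.+1%:R^-1) * IG + 0 < 0.
      by rewrite mulrBl IGV mulN1r addr0 addKr oppr_lt0.
    have a2 := ae_foralln (fun k => sums _ _ _ (s2 k)).
    have a3 := ae_foralln (fun k => sums _ _ _ (s3 k)).
    by apply: filterS3 (sums _ _ _ s1) a2 a3 => w.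
  have late_eq := ae_late (process (dirac x)) lam_ge0 lam_measurable L0 lam_lip M_int lam_le
    tstar_gt0 mA t_ge0 t_lt.
  apply: filterS2 all_sums late_eq => w [[N3 h3] h1 h2] eqJ.
  rewrite ell.
  pose Y n := Yrisk Z S A t n w.
  pose XX n := \sum_(i < n) lam (Z i w) t * \1_A (Z i w) * ((t%:E <= S i.+1 w)%E)%:R.
  have linear alpha beta c n : \sum_(i < n)
      ((alpha * lam (Z i w) t + beta) * \1_A (Z i w) * \1_(J i) w + c) =
      alpha * XX n + beta * Y n + n%:R * c.
    rewrite (eq_bigr (fun i : 'I_n =>
        alpha * (lam (Z i w) t * \1_A (Z i w) * ((t%:E <= S i.+1 w)%E)%:R) +
        beta * (((t%:E <= S i.+1 w)%E)%:R * \1_A (Z i w)) + c)); last first.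
      by move=> i _; rewrite -mulrA (mulrC (\1_A _) (\1_(J i) w)) -eqJ; ring.
    by rewrite !big_split/= -!mulr_sumr sumr_const card_ord mulr_natl.
  apply: (@ratio_cvg R XX Y (IF / IG) (IG / 2)); first by rewrite divr_gt0.
  + exists N3%:R => n; have := h3 n; rewrite linear; lra.
  + move=> k; have [N hN] := h1 k; exists N%:R => n.
    by have := hN n; rewrite linear mul1r mulNr mulr0 addr0.
  + move=> k; have [N hN] := h2 k; exists N%:R => n.
    by have := hN n; rewrite linear mulN1r mulr0 addr0 addrC.
- apply: continuous_subspaceW cont_l => s [s0 _].
  by rewrite /= in_itv/= andbT.
Qed.
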